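(* Let $X$ be a non-separable (real or complex) rearrangement invariant space on $\mathbb{N}$. If $X$ has the alternative Daugavet property, then $X$ is $\ell_\infty$ (with its usual norm).
   Context: $\mathbb{N}$ carries counting measure. A Köthe function space on $\mathbb{N}$ is a real or complex Banach space $X$ of scalar sequences such that: (i) if $|f|\le|g|$ pointwise and $g\in X$, then $f\in X$ and $\|f\|\le\|g\|$; (ii) $\boldsymbol{1}_A\in X$ for every finite $A\subset\mathbb{N}$. $X'\subset X^*$ denotes the space of integrals, i.e. functionals $f\mapsto\sum_n f(n)g(n)$ with $g$ a sequence such that $gf\in\ell_1$ for all $f\in X$ (identified with $g$), with the norm of $X^*$; it is again a Köthe function space, and $X''=(X')'$. A Köthe function space $X$ on $\mathbb{N}$ is rearrangement invariant (r.i.) if: (1) for every bijection $\tau$ of $\mathbb{N}$ and integrable $f$, $f\in X$ iff $f\tau^{-1}\in X$, and then $\|f\|=\|f\tau^{-1}\|$; (2) $X'$ is a norming subspace of $X^*$ (so $X$ is isometrically a subspace of $X''$), and $X=X''$ or $X$ is the closed linear span of the simple integrable functions of $X''$; (3) $\ell_1\subset X\subset\ell_\infty$ with $\|f\|_X\le\|f\|_1$ for $f\in\ell_1$ and $\|f\|_\infty\le\|f\|_X$ for $f\in X$. Alternative Daugavet property: every rank-one bounded operator $T$ on $X$ satisfies $\max_{|\theta|=1}\|\mathrm{Id}+\theta T\|=1+\|T\|$ ($\theta$ ranging over scalars of modulus one). *)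

(* Defs.v *)
From mathcomp Require Import all_boot all_order all_algebra.
From mathcomp Require Import all_classical all_reals all_analysis.
From mathcomp Require Export complex.
Import Order.TTheory GRing.Theory Num.Theory.
Import numFieldNormedType.Exports.

Set Implicit Arguments.
Unset Strict Implicit.
Unset Printing Implicit Defensive.

Local Open Scope classical_set_scope.
Local Open Scope ring_scope.

(* All definitions are generic in the scalar field K, to be instantiated with
   R and R[i] for R : realType.  As usual for normedModType, norms take their
   values in K; the suprema below are least upper bounds for the (partial)
   order of K, which on sets of nonnegative elements of R[i] are the suprema
   of real numbers. *)

Definition in_l1 (K : numFieldType) (f : K^nat) : Prop :=
  cvgn [normed series f].

Definition l1_norm (K : numFieldType) (f : K^nat) : K :=
  limn [normed series f].

Definition in_linfty (K : numFieldType) (f : K^nat) : Prop := bounded_fun f.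

Definition linfty_norm (K : numFieldType) (f : K^nat) : K :=
  supremum 0 (range (fun n => `|f n|)).

(* A Banach space of scalar sequences is a complete normed module X together
   with an injective linear map c sending an element of X to the sequence it
   is; a sequence f belongs to the space when f lies in range c. *)
Record kothe_space (K : numFieldType) (X : completeNormedModType K)
    (c : {linear X -> (nat -> K^o)}) : Prop := KotheSpace {
  kothe_inj : injective c;
  kothe_ideal : forall (f : K^nat) (g : X),
    (forall n, `|f n| <= `|c g n|) -> exists2 h : X, c h = f & `|h| <= `|g|;
  kothe_indic : forall A : set nat, finite_set A -> range c \1_A
}.

Definition pairing (K : numFieldType) (f g : K^nat) : K :=
  limn (series (fun n => f n * g n)).

(* The space of integrals of a sequence space only depends on its underlying
   set S of sequences; its norm, that of the dual Banach space, only depends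
   on the closed unit ball B. *)
Definition kdual (K : numFieldType) (S : set K^nat) : set K^nat :=
  [set g | forall f, S f -> in_l1 (fun n => g n * f n)].

Definition kdual_norm (K : numFieldType) (B : set K^nat) (g : K^nat) : K :=
  supremum 0 [set `|pairing f g| | f in B].

Definition kdual_ball (K : numFieldType) (S B : set K^nat) : set K^nat :=
  [set g | kdual S g /\ kdual_norm B g <= 1].

Section Bidual.
Context (K : numFieldType) (X : completeNormedModType K)
  (c : {linear X -> (nat -> K^o)}).

Definition seq_ball : set K^nat := c @` [set x : X | `|x| <= 1].

(* X'' = (X')' *)
Definition bidual : set K^nat := kdual (kdual (range c)).

Definition bidual_norm (f : K^nat) : K :=
  kdual_norm (kdual_ball (range c) seq_ball) f.

Definition simple_integrable (f : K^nat) : Prop :=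
  finite_set (range f) /\ in_l1 f.

Definition linear_span (S : set K^nat) : set K^nat :=
  [set f | exists n (a : 'I_n -> K) (s : 'I_n -> K^nat),
    (forall i, S (s i)) /\ f = (fun k => \sum_(i < n) a i * s i k)].

Definition bidual_closed_span (S : set K^nat) : set K^nat :=
  [set f | bidual f /\ forall e : K, 0 < e ->
    exists2 s, linear_span S s & bidual_norm (fun k => f k - s k) < e].

End Bidual.

Record ri_space (K : numFieldType) (X : completeNormedModType K)
    (c : {linear X -> (nat -> K^o)}) : Prop := RiSpace {
  ri_kothe : kothe_space c;
  ri_rearrange : forall tau tauV : nat -> nat,
    cancel tau tauV -> cancel tauV tau ->
    forall f : K^nat, in_l1 f ->
      (range c f <-> range c (f \o tauV)) /\
      (forall x y : X, c x = f -> c y = f \o tauV -> `|x| = `|y|);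
  (* X' is norming *)
  ri_norming : forall x : X, `|x| = bidual_norm c (c x);
  ri_bidual : range c = bidual c \/
    range c = bidual_closed_span c [set f | bidual c f /\ simple_integrable f];
  ri_l1 : forall f : K^nat, in_l1 f ->
    exists2 x : X, c x = f & `|x| <= l1_norm f;
  ri_linfty : forall x : X, in_linfty (c x) /\ linfty_norm (c x) <= `|x|
}.

Definition separable (T : topologicalType) : Prop :=
  exists D : set T, countable D /\ dense D.

Section Operators.
Context (K : numFieldType) (X : normedModType K).

Definition bounded_operator (T : X -> X) : Prop :=
  exists C : K, forall x, `|T x| <= C * `|x|.

Definition operator_norm (T : X -> X) : K :=
  supremum 0 [set `|T x| | x in [set x : X | `|x| <= 1]].

Definition rank_one (T : X -> X) : Prop :=
  exists2 y : X, y != 0 & range T = range (fun a : K => a *: y).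

Definition is_max (A : set K) (m : K) : Prop := A m /\ ubound A m.

Definition alternative_Daugavet : Prop :=
  forall T : {linear X -> X}, bounded_operator T -> rank_one T ->
    is_max [set operator_norm (fun x => x + theta *: T x)
             | theta in [set theta : K | `|theta| = 1]]
           (1 + operator_norm T).

End Operators.

Arguments alternative_Daugavet {K} X.

Definition is_linfty (K : numFieldType) (X : completeNormedModType K)
    (c : {linear X -> (nat -> K^o)}) : Prop :=
  range c = @in_linfty K /\ forall x : X, `|x| = linfty_norm (c x).

(* Main.v *)
From HB Require Import structures.
Require Import Defs.
From mathcomp Require Import all_boot all_order all_algebra.
From mathcomp Require Import all_classical all_reals all_analysis.
From mathcomp Require Import ring lra.
Import Order.TTheory GRing.Theory Num.Theory.
Import numFieldNormedType.Exports.
Local Open Scope ring_scope.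
Set Implicit Arguments.
Unset Strict Implicit.
Unset Printing Implicit Defensive.

(** Write phi(m) for the norm of the indicator of m points.  It suffices to
prove phi <= 1.  Indeed, a non-separable X cannot be the closed span of finitely
supported sequences, so X = X''; and phi <= 1 forces X' to consist of summable
sequences, so that X'' contains every bounded sequence and the norm of X is the
supremum norm.

The property is applied to the operators z |-> h(z) u, where u is a unit vector
and h a functional given by a finite sequence.  It provides y in the unit ball
such that y + theta h(y) u has norm almost 1 + ||h||.  Then y almost attains the
norm of h, and an element g of the unit ball of X' that almost norms this sum
must almost norm both u and y.  Replacing u by the normalized sum and iterating
over a finite list of functionals h ([adp_list]), one finds g that almost norms
u and, for every h of the list, almost norms some y which almost maximizes |h|.

The list may be extended when the first vectors y are known, but it cannot
depend on g, which comes last.  Total boundedness repairs this: the second list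
is a net of all functionals supported by the finitely many coordinates in use,
so it contains an approximation of any functional built from g on these
coordinates.  Taking h close to sigma e_i - sum_(j != i) g_j e_j, with sigma the
sign of g_i, one gets y on which the i-th coordinate and the rest of g pull in
opposite directions, whereas |g(y)| is almost 1; this is possible only if |g_i|
is almost 0 or almost 1 ([zero_one_norming]).

Apply this to the normalized indicator u of M points: phi(M) is almost the
number of coordinates at which |g_i| is almost 1, and that many coordinates of a
dual unit vector being almost 1 means, by rearrangement, that phi(j) = j for
this number j.  Hence phi(k+1) < k+1 implies phi <= k ([fundamental_bounded]).
If phi(2) = 2, then |x_i| + |x_j| <= ||x||, so a vector which almost maximizes a
coordinate is almost a unit vector once phi is bounded; all |g_i| with i <= k
are then almost 1 and phi(k+1) = k+1 ([fundamental_full]).  So phi(m) = m for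
all m, the norm dominates that of l1, truncations converge and X is separable, a
contradiction.  Therefore phi(2) < 2, and phi <= 1. *)

(** * Sums, words and real inequalities *)

Lemma sum_ord_cat (V : nmodType) (F : nat -> V) N M : (N <= M)%N ->
  \sum_(i < M) F i = \sum_(i < N) F i + \sum_(N <= i < M) F i.
Proof.
by move=> NM; rewrite -!(big_mkord xpredT F) (big_cat_nat (leq0n N) NM).
Qed.

Lemma lt_bigmax (s : seq nat) i : i \in s -> (i < (\max_(j <- s) j).+1)%N.
Proof. by move=> si; rewrite ltnS; apply: (@leq_bigmax_seq _ s xpredT id). Qed.

Lemma sum_indicator (R : pzSemiRingType) (s : seq nat) (p : pred nat) :
  \sum_(i <- s) (p i)%:R = (count p s)%:R :> R.
Proof.
elim: s => [|a s IH]; first by rewrite big_nil.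
by rewrite big_cons IH /= natrD.
Qed.

Fixpoint words (T : Type) (L : seq T) N : seq (seq T) :=
  if N is N'.+1 then [seq rcons s a | s <- words L N', a <- L] else [:: [::]].

Lemma mem_words (T : eqType) (L : seq T) N f : (forall i, f i \in L) ->
    mkseq f N \in words L N.
Proof.
move=> fL; elim: N => [|N IH] /=; first by rewrite mem_seq1.
by rewrite mkseqS; apply/allpairsP; exists (mkseq f N, f N); split=> //=; apply: fL.
Qed.

Lemma le_of_le_add (R : realType) (a b d : R) : 0 <= d ->
  (forall eps, 0 < eps -> a <= b + eps * d) -> a <= b.
Proof.
move=> d0 H; apply/ler_addgt0Pr => eps eps0.
have d1 : 0 < 1 + d by rewrite ltr_wpDr.
apply: le_trans (H (eps / (1 + d)) _) _; first by rewrite divr_gt0.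
rewrite lerD2l mulrAC ler_pdivrMr //; nra.
Qed.

(** Here t stands for the modulus of a coordinate of a functional, b for |v|, Q
for |q| and L, S for |v - q|, |t v + q|.  For d = 0 the hypotheses give r = 0
and (1 - t)(1 - b) = 0; if t < 1 then b = 1, Q = 1 - t and L = 2 - t, S = 1, so
that the parallelogram identity reads t (2 - t)^2 + 1 <= 1 + t^3, that is
4 t (1 - t) <= 0.  The choice of d keeps the errors, of order d / eps, below
what t (1 - t) can be when t is at distance eps from both 0 and 1. *)
Lemma near_endpoint (R : realType) (t eps d b Q r L S : R) :
  0 <= t -> 0 < eps <= 1 -> 16 * d = eps ^+ 3 ->
  0 <= b <= 1 -> 0 <= Q -> 0 <= r -> 0 <= S ->
  t * b + Q + r <= 1 -> L <= b + Q -> 2 - t - 5 * d <= L -> 1 - d <= S + r ->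
  t * L ^+ 2 + S ^+ 2 = (1 + t) * (t * b ^+ 2 + Q ^+ 2) ->
  t <= eps \/ 1 - eps <= t.
Proof.
move=> t0 /andP[e0 _] dE /andP[b0 b1] Q0 r0 S0 sum1 L1 hL hS para.
have [te|te] := leP t eps; first by left.
have [te'|te'] := leP (1 - eps) t; first by right.
exfalso.
have d0 : 0 < d by rewrite -(pmulr_rgt0 _ (_ : 0 < 16)) ?ltr0n // dE exprn_gt0.
have t1 : t <= 1 by lra.
have e32 : eps ^+ 3 <= eps ^+ 2 by rewrite exprS ler_piMl ?exprn_ge0 ?ltW //; lra.
have [w0 [w1 [w16 r5]]] : 0 <= 1 - b /\ 1 - b <= 1 /\
    16 * (1 - b) <= 5 * eps ^+ 2 /\ r <= 5 * d.
  clear para S0 hS e32.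
  have tb : t * b <= t by rewrite ler_piMr.
  have bt : b * (1 - t) <= 1 - t by rewrite ler_piMl ?subr_ge0.
  have ew : eps * (1 - b) <= (1 - t) * (1 - b).
    by rewrite ler_wpM2r ?subr_ge0 //; lra.
  split; first lra; split; first lra; split; last lra.
  rewrite -(ler_pM2l e0); have -> : eps * (5 * eps ^+ 2) = 5 * eps ^+ 3 by ring.
  by rewrite -dE; lra.
have upper : (1 + t) * (t * b ^+ 2 + Q ^+ 2) <= 1 + t ^+ 3 + 2 * (1 - b).
  clear para hL hS e32 r5 w16 dE L1 S0.
  have Q2 : Q ^+ 2 <= (1 - t * b) ^+ 2.
    have tb : t * b <= 1 by rewrite mulr_ile1.
    by rewrite ler_sqr ?nnegrE //; lra.
  pose w := 1 - b; have bw : b = 1 - w by rewrite /w; ring.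
  have Q3 : (1 - t * b) ^+ 2 <= (1 - t) ^+ 2 + w.
    rewrite bw; have -> : (1 - t * (1 - w)) ^+ 2 =
      (1 - t) ^+ 2 + w * (2 * t * (1 - t) + t ^+ 2 * w) by ring.
    have t2w : t ^+ 2 * w <= t ^+ 2 by rewrite ler_piMr ?sqr_ge0.
    rewrite lerD2l ler_piMr //; have := sqr_ge0 (1 - t); lra.
  have tb2 : t * b ^+ 2 <= t by rewrite ler_piMr // expr_le1.
  have tw : t * w <= w by rewrite ler_piMl.
  apply: (@le_trans _ _ ((1 + t) * (t + ((1 - t) ^+ 2 + w)))).
    by rewrite ler_wpM2l ?addr_ge0 //; lra.
  have -> : (1 + t) * (t + ((1 - t) ^+ 2 + w)) = 1 + t ^+ 3 + (w + t * w) by ring.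
  by rewrite -/w; lra.
have d2 := sqr_ge0 d.
have S2 : 1 - 12 * d <= S ^+ 2.
  have S6 : 1 - 6 * d <= S by lra.
  clear - S6 d2 S0.
  have [neg|pos] := leP (1 - 6 * d) 0; first by have := sqr_ge0 S; lra.
  have : (1 - 6 * d) ^+ 2 <= S ^+ 2 by rewrite ler_sqr ?nnegrE // ltW.
  lra.
have t2 : 0 <= 2 - t by lra.
have L2 : (2 - t) ^+ 2 - 10 * d * (2 - t) <= L ^+ 2.
  clear - hL t2 d2 d0.
  have [neg|pos] := leP (2 - t - 5 * d) 0.
    have d10 : 0 <= 10 * d - (2 - t) by lra.
    by have := mulr_ge0 t2 d10; have := sqr_ge0 L; lra.
  have : (2 - t - 5 * d) ^+ 2 <= L ^+ 2.
    by rewrite ler_sqr ?nnegrE //; lra.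
  lra.
have L3 : t * (2 - t) ^+ 2 - 10 * d <= t * L ^+ 2.
  clear - L2 d0 t0.
  have : t * ((2 - t) ^+ 2 - 10 * d * (2 - t)) <= t * L ^+ 2 by rewrite ler_wpM2l.
  have : d * (t * (2 - t)) <= d.
    by rewrite ler_piMr ?(ltW d0) //; have := sqr_ge0 (1 - t); lra.
  lra.
have key : 4 * t * (1 - t) <= 2 * eps ^+ 2.
  clear - L3 S2 upper para w16 dE e32.
  have e3 : t * (2 - t) ^+ 2 + 1 - (1 + t ^+ 3) = 4 * t * (1 - t) by ring.
  lra.
clear - key te te' e0.
have m1 : 0 <= (t - eps) * (1 - t - eps) by apply: mulr_ge0; lra.
have m2 : 0 < eps * (1 / 2 - eps) by apply: mulr_gt0; lra.
lra.
Qed.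

(** * Real and complex scalars *)

(** What the argument uses of the scalars: R sits in K, nonnegative elements of K
are real, the plane K is Euclidean, and its unit disc is totally bounded.  It
allows norms, which are K-valued, to be handled in R through [rho]. *)
Record real_scalars (R : realType) (K : numFieldType)
    (emb : {rmorphism R -> K}) (rho : K -> R) : Prop := RealScalars {
  emb_le : forall x y : R, (emb x <= emb y) = (x <= y);
  emb_rho : forall z : K, 0 <= z -> emb (rho z) = z;
  weighted_parallelogram : forall (t : R) (v q : K),
    t * rho `|v - q| ^+ 2 + rho `|emb t * v + q| ^+ 2 =
    (1 + t) * (t * rho `|v| ^+ 2 + rho `|q| ^+ 2);
  disc_net : forall n : nat, exists L : seq K, forall z : K, `|z| <= 1 ->
    exists2 w, w \in L & rho `|z - w| < n.+1%:R^-1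
}.

Section Scalars.
Context (R : realType) (K : numFieldType).
Context (emb : {rmorphism R -> K}) (rho : K -> R).
Hypothesis scalars : real_scalars emb rho.

Local Notation nm x := (rho `|x|).

Lemma emb_inj : injective emb.
Proof.
by move=> x y e; apply/le_anti; rewrite -!(emb_le scalars) e lexx.
Qed.

Lemma emb_ge0 r : (0 <= emb r) = (0 <= r).
Proof. by rewrite -(rmorph0 emb) (emb_le scalars). Qed.

Lemma rhoK r : 0 <= r -> rho (emb r) = r.
Proof. by move=> r0; apply: emb_inj; rewrite (emb_rho scalars) ?emb_ge0. Qed.

Lemma rho_ge0 z : 0 <= z -> 0 <= rho z.
Proof. by move=> z0; rewrite -emb_ge0 (emb_rho scalars). Qed.

Lemma ler_rho x y : 0 <= x -> 0 <= y -> (rho x <= rho y) = (x <= y).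
Proof. by move=> x0 y0; rewrite -(emb_le scalars) !(emb_rho scalars). Qed.

Lemma emb_gt0 r : (0 < emb r) = (0 < r).
Proof. by rewrite !lt_def emb_ge0 -(rmorph0 emb) (inj_eq emb_inj). Qed.

Lemma rho_gt0 z : 0 < z -> 0 < rho z.
Proof. by move=> z0; rewrite -emb_gt0 (emb_rho scalars (ltW z0)). Qed.

Lemma nmE (V : normedZmodType K) (x : V) : emb (nm x) = `|x|.
Proof. by rewrite (emb_rho scalars). Qed.

Lemma nm_ge0 (V : normedZmodType K) (x : V) : 0 <= nm x.
Proof. by rewrite rho_ge0. Qed.

Lemma nm_le (V W : normedZmodType K) (x : V) (y : W) :
  (nm x <= nm y) = (`|x| <= `|y|).
Proof. by rewrite ler_rho. Qed.

Lemma nm_le_emb (V : normedZmodType K) (x : V) r : (nm x <= r) = (`|x| <= emb r).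
Proof. by rewrite -(emb_le scalars) nmE. Qed.

Lemma nm_lt_emb (V : normedZmodType K) (x : V) r : (nm x < r) = (`|x| < emb r).
Proof.
by rewrite !lt_neqAle -(emb_le scalars) -(inj_eq emb_inj) nmE.
Qed.

Lemma nmD (V : normedZmodType K) (x y : V) : nm (x + y) <= nm x + nm y.
Proof. by rewrite nm_le_emb rmorphD /= !nmE ler_normD. Qed.

Lemma nmN (V : normedZmodType K) (x : V) : nm (- x) = nm x.
Proof. by rewrite normrN. Qed.

Lemma nmB (V : normedZmodType K) (x y : V) : nm (x - y) <= nm x + nm y.
Proof. by rewrite -(nmN y) nmD. Qed.

Lemma nm0 (V : normedZmodType K) : nm (0 : V) = 0.
Proof. by apply: emb_inj; rewrite nmE normr0 rmorph0. Qed.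

Lemma nm_eq0 (V : normedZmodType K) (x : V) : nm x = 0 -> x = 0.
Proof. by move=> e; apply/eqP; rewrite -normr_eq0 -nmE e rmorph0. Qed.

Lemma nm1 : nm (1 : K) = 1.
Proof. by apply: emb_inj; rewrite nmE normr1 rmorph1. Qed.

Lemma nmM (x y : K) : nm (x * y) = nm x * nm y.
Proof. by apply: emb_inj; rewrite rmorphM /= !nmE normrM. Qed.

Lemma nmZ (V : normedModType K) (a : K) (x : V) : nm (a *: x) = nm a * nm x.
Proof. by apply: emb_inj; rewrite rmorphM /= !nmE normrZ. Qed.

Lemma nm_emb r : 0 <= r -> nm (emb r) = r.
Proof. by move=> r0; rewrite ger0_norm ?emb_ge0 ?rhoK. Qed.

Lemma nm_nm (V : normedZmodType K) (x : V) : nm (`|x| : K) = nm x.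
Proof. by rewrite normr_id. Qed.

Lemma nm_sum (V : normedZmodType K) (I : Type) (r : seq I) (P : pred I)
    (F : I -> V) :
  nm (\sum_(i <- r | P i) F i) <= \sum_(i <- r | P i) nm (F i).
Proof.
elim/big_ind2: _ => [|x1 x2 y1 y2 h1 h2|//]; first by rewrite nm0.
by apply: (le_trans (nmD _ _)); apply: lerD.
Qed.

(** The conjugate of the sign of a. *)
Definition phase (a : K) : K := if a == 0 then 1 else `|a| / a.

Lemma mul_phase a : a * phase a = `|a|.
Proof.
rewrite /phase; case: eqP => [->|/eqP a0]; first by rewrite mul0r normr0.
by rewrite mulrCA divff ?mulr1.
Qed.

Lemma norm_phase a : `|phase a| = 1.
Proof.
rewrite /phase; case: eqP => [_|/eqP a0]; first by rewrite normr1.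
by rewrite normrM normfV normr_id divff ?normr_eq0.
Qed.

Lemma nm_phase a : nm (phase a) = 1.
Proof. by apply: emb_inj; rewrite nmE norm_phase rmorph1. Qed.

(** [supremum 0] returns 0 on a set without least upper bound, so boundedness
has to be established before the suprema of the definitions mean anything; on a
bounded set of nonnegative elements it is the real supremum. *)
Lemma supremum_lub (A : set K) (B : R) : (A !=set0)%classic ->
  (forall a, A a -> 0 <= a /\ a <= emb B) ->
  exists s : R, [/\ supremum 0 A = emb s, forall a, A a -> rho a <= s
    & forall e, 0 < e -> exists2 a, A a & s - e < rho a].
Proof.
move=> A0 AB; pose s := sup [set rho a | a in A]%classic.
have hs : has_sup [set rho a | a in A]%classic.
  split; first by case: A0 => a Aa; exists (rho a); exists a.
  exists B => _ [a Aa <-]; have [a0 aB] := AB _ Aa.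
  by rewrite -(emb_le scalars) (emb_rho scalars).
have ubs a : A a -> rho a <= s.
  by move=> Aa; apply: sup_upper_bound => //; exists a.
exists s; split=> //; last first.
  by move=> e e0; have [_ [a Aa <-] lt] := sup_adherent e0 hs; exists a.
have sP : supremums A (emb s).
  split=> [a Aa|b ubb].
    have [a0 _] := AB _ Aa.
    by rewrite -(emb_rho scalars a0) (emb_le scalars) ubs.
  have b0 : 0 <= b.
    by case: A0 => a Aa; apply: le_trans (ubb _ Aa); case: (AB _ Aa).
  rewrite -(emb_rho scalars b0) (emb_le scalars).
  apply: ge_sup; first by case: hs.
  move=> _ [a Aa <-]; have [a0 _] := AB _ Aa.
  by rewrite ler_rho //; apply: ubb.
rewrite /supremum; case: eqP => [A00|_].
  by case: A0 => a; rewrite A00.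
have [u1 l1] := xgetI 0 sP.
by case: sP => u2 l2; apply/le_anti/andP; split; [apply: l1|apply: l2].
Qed.


Lemma zero_one_scalar (t eps : R) (v q r : K) : 0 <= t -> 0 < eps <= 1 ->
  nm v <= 1 -> t * nm v + nm q + nm r <= 1 ->
  2 - t - 5 * (eps ^+ 3 / 16) <= nm (v - q) ->
  1 - eps ^+ 3 / 16 <= nm (emb t * v + q + r) ->
  t <= eps \/ 1 - eps <= t.
Proof.
move=> t0 eps01 v1 sum1 hL hS.
apply: (@near_endpoint R t eps (eps ^+ 3 / 16) (nm v) (nm q) (nm r)
  (nm (v - q)) (nm (emb t * v + q))); rewrite ?nm_ge0 //.
- by field.
- exact: nmB.
- by apply: le_trans hS _; apply: nmD.
exact: weighted_parallelogram.
Qed.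

Lemma in_linftyP (f : K^nat) :
  in_linfty f <-> exists B : R, forall n, nm (f n) <= B.
Proof.
have PF : ProperFilter (globally [set: nat]%classic).
  exact: (@globally_properfilter _ _ 0%N).
split=> [|[B fB]].
  move/ex_bound => [M /= fM].
  have fM' n : `|f n| <= M by apply: fM.
  have M0 : 0 <= M := le_trans (normr_ge0 _) (fM' 0%N).
  by exists (rho M) => n; rewrite ler_rho.
by apply/ex_bound; exists (emb B) => n _ /=; rewrite -nm_le_emb.
Qed.

Lemma in_l1_bound (f : K^nat) : in_l1 f ->
  exists B : R, forall N, \sum_(i < N) nm (f i) <= B.
Proof.
have PF : ProperFilter (globally [set: nat]%classic).
  exact: (@globally_properfilter _ _ 0%N).
move=> /cvg_seq_bounded /ex_bound [M /= fM].
have fM' n : \sum_(i < n) `|f i| <= M.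
  have := fM n I; rewrite /= /series /= big_mkord; apply: le_trans.
  by rewrite ger0_norm // sumr_ge0.
have M0 : 0 <= M by have := fM' 0%N; rewrite big_ord0.
exists (rho M) => N; rewrite -(emb_le scalars) (emb_rho scalars) // rmorph_sum /=.
by under eq_bigr do rewrite nmE; exact: fM'.
Qed.

Lemma bound_in_l1 (f : K^nat) (B : R) :
  (forall N, \sum_(i < N) nm (f i) <= B) -> in_l1 f.
Proof.
move=> fB; pose r : R^nat := fun N => \sum_(i < N) nm (f i).
have cr : cvgn r.
  apply: nondecreasing_is_cvgn; last by exists B => _ [N _ <-]; exact: fB.
  apply/nondecreasing_seqP => n; rewrite /r big_ord_recr /= lerDl.
  exact: nm_ge0.
apply/cvg_ex; exists (emb (limn r) : K^o).
apply/(@cvgrPdist_lt _ K^o) => eps eps0.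
have e0 := rho_gt0 eps0.
move/cvgrPdist_lt: cr => /(_ _ e0).
apply: filterS => N /= h; rewrite -(emb_rho scalars (ltW eps0)).
have -> : series (fun n => `|f n|) N = emb (r N).
  rewrite /series /= big_mkord rmorph_sum.
  by apply: eq_bigr => i _; rewrite /= nmE.
rewrite -rmorphB /= -nm_lt_emb.
suff -> : nm (emb (limn r - r N)) = `|limn r - r N| by [].
move: (limn r - r N) => a; apply: emb_inj; rewrite nmE.
have [a0|a0] := leP 0 a; first by rewrite !ger0_norm ?emb_ge0.
by rewrite (ltr0_norm a0) rmorphN ler0_norm //
    -oppr_ge0 -rmorphN emb_ge0 oppr_ge0 ltW.
Qed.

Lemma series_finite_support (u : K^nat) N : (forall i, (N <= i)%N -> u i = 0) ->
  (series u @ \oo --> (\sum_(i < N) u i : K^o))%classic.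
Proof.
move=> u0; apply: cvg_near_cst; exists N => // n /= Nn.
rewrite /series /= -(big_mkord xpredT u).
rewrite (big_cat_nat (leq0n N) Nn) //= [X in _ + X](_ : _ = 0) ?addr0 //.
by rewrite big_nat_cond big1 // => i /andP[/andP[Ni _] _]; apply: u0.
Qed.

Lemma limn_finite_support (u : K^nat) N : (forall i, (N <= i)%N -> u i = 0) ->
  limn (series u : (K^o)^nat) = \sum_(i < N) u i.
Proof.
by move=> u0; apply: cvg_lim; [exact: norm_hausdorff|exact: series_finite_support].
Qed.

Lemma finite_support_l1 (f : K^nat) N : (forall i, (N <= i)%N -> f i = 0) ->
  in_l1 f /\ l1_norm f = \sum_(i < N) `|f i|.
Proof.
move=> f0; have f0' i : (N <= i)%N -> `|f i| = 0 by move=> /f0 ->; rewrite normr0.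
split; last exact: (limn_finite_support f0').
by apply/cvg_ex; eexists; apply: (series_finite_support f0').
Qed.

(** * Coordinates, truncations and unit vectors *)

Section Space.
Context (X : completeNormedModType K) (c : {linear X -> (nat -> K^o)}).
Hypothesis X_ri : ri_space c.

Definition coord (x : X) (i : nat) : K := c x i.

Lemma coordD x y i : coord (x + y) i = coord x i + coord y i.
Proof. by rewrite /coord linearD. Qed.

Lemma coordZ a x i : coord (a *: x) i = a * coord x i.
Proof. by rewrite /coord linearZ. Qed.

Lemma coordB x y i : coord (x - y) i = coord x i - coord y i.
Proof. by rewrite /coord linearB. Qed.

Lemma coord0 i : coord 0 i = 0.
Proof. by rewrite /coord linear0. Qed.

Lemma coord_sum (J : Type) (r : seq J) (P : pred J) (F : J -> X) i :
  coord (\sum_(j <- r | P j) F j) i = \sum_(j <- r | P j) coord (F j) i.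
Proof.
apply: (big_morph (coord^~ i) (fun x y => coordD x y i) (coord0 i)).
Qed.

Lemma coord_inj x y : coord x =1 coord y -> x = y.
Proof.
by move=> e; apply: (kothe_inj (ri_kothe X_ri)); apply/funext => i; apply: e.
Qed.

Lemma coord_ideal (f : K^nat) x : (forall n, nm (f n) <= nm (coord x n)) ->
  exists y, coord y =1 f /\ nm y <= nm x.
Proof.
move=> fx; have fx' n : `|f n| <= `|c x n| by rewrite -nm_le; apply: fx.
have [y cy yx] := kothe_ideal (ri_kothe X_ri) fx'.
by exists y; split=> [i|]; [rewrite /coord cy|rewrite nm_le].
Qed.

Lemma le_of_coord x y : (forall n, nm (coord x n) <= nm (coord y n)) ->
    nm x <= nm y.
Proof.
by move=> xy; have [z [zx zy]] := coord_ideal xy; rewrite -(coord_inj zx).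
Qed.

Lemma nm_coord x n : nm (coord x n) <= nm x.
Proof.
have [bx lx] := ri_linfty X_ri x.
have [B xB] := (in_linftyP _).1 bx.
have [|a [k _ <-]|s [es us _]] := @supremum_lub (range (fun n => `|c x n|)) B.
- by exists `|c x 0%N|; exists 0%N.
- by split=> //; rewrite -nm_le_emb; apply: xB.
apply: (@le_trans _ _ s); first by apply: us; exists n.
by rewrite -(emb_le scalars) nmE -es.
Qed.

Definition unit_vec (n : nat) : X :=
    xget 0 [set x | forall m, coord x m = (m == n)%:R]%classic.

Lemma coord_unit n m : coord (unit_vec n) m = (m == n)%:R.
Proof.
have [x _ xE] := kothe_indic (ri_kothe X_ri) (finite_set1 n).
have : [set x | forall m, coord x m = (m == n)%:R]%classic x.
  move=> k; rewrite /coord xE indicE; congr (_%:R); congr nat_of_bool.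
  by apply/idP/eqP => [|->]; rewrite in_setE.
by move/(xgetI 0); apply.
Qed.

Lemma nm_unit n : nm (unit_vec n) = 1.
Proof.
have z i : (n.+1 <= i)%N -> c (unit_vec n) i = 0.
  by move=> ni; rewrite -/(coord _ _) coord_unit gtn_eqF.
have [h1 h2] := finite_support_l1 z.
have [x xe xle] := ri_l1 X_ri h1.
have ex : x = unit_vec n by apply: coord_inj => i; rewrite /coord xe.
apply/le_anti/andP; split; last first.
  by have := nm_coord (unit_vec n) n; rewrite coord_unit eqxx nm1.
rewrite nm_le_emb rmorph1; move: xle; rewrite ex h2 => /le_trans; apply.
rewrite (bigD1 ord_max) //= big1 ?addr0; last first.
  move=> i; rewrite -val_eqE /= -/(coord _ _) coord_unit => /negPf ->.
  by rewrite normr0.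
by rewrite -/(coord _ _) coord_unit eqxx normr1.
Qed.

Definition fin_vec N (f : K^nat) : X := \sum_(i < N) f i *: unit_vec i.

Lemma coord_fin_vec N f j : coord (fin_vec N f) j = if (j < N)%N then f j else 0.
Proof.
rewrite /fin_vec coord_sum; under eq_bigr do rewrite coordZ coord_unit.
case: ltnP => jN.
  rewrite (bigD1 (Ordinal jN)) //= eqxx mulr1 big1 ?addr0 // => i.
  by rewrite -val_eqE /= eq_sym => /negPf ->; rewrite mulr0.
rewrite big1 // => i _; rewrite gtn_eqF ?mulr0 //.
exact: leq_trans (ltn_ord i) jN.
Qed.

Definition supported N x := forall i, (N <= i)%N -> coord x i = 0.

Lemma supported_fin_vec N f : supported N (fin_vec N f).
Proof. by move=> i Ni; rewrite coord_fin_vec ltnNge Ni. Qed.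

Lemma supported_le N M x : (N <= M)%N -> supported N x -> supported M x.
Proof. by move=> NM sx i Mi; apply: sx; apply: leq_trans Mi. Qed.

Lemma supported_unit n N : (n < N)%N -> supported N (unit_vec n).
Proof. by move=> nN i Ni; rewrite coord_unit gtn_eqF //; apply: leq_trans Ni. Qed.

Definition truncate N x := fin_vec N (coord x).

Lemma nm_truncate N x : nm (truncate N x) <= nm x.
Proof.
by apply: le_of_coord => n; rewrite coord_fin_vec; case: ifP => // _;
  rewrite nm0 nm_ge0.
Qed.

Lemma le_fin_vec N f x : (forall i, (i < N)%N -> nm (f i) <= nm (coord x i)) ->
  nm (fin_vec N f) <= nm x.
Proof.
move=> fx; apply: le_of_coord => n; rewrite coord_fin_vec; case: ifP => [/fx//|_].
by rewrite nm0 nm_ge0.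
Qed.

(** * The unit ball of the space of integrals *)

(** The unit ball of X', written with partial sums of absolute values: by the
ideal property this is the same as bounding the pairing itself. *)
Definition dual_ball (g : nat -> K) := forall x N,
  \sum_(i < N) nm (g i) * nm (coord x i) <= nm x.

Definition dot N (g : nat -> K) (x : X) : K := \sum_(i < N) g i * coord x i.

(** The bound also holds when u diverges, since its limit is then 0. *)
Lemma nm_limn (u : (K^o)^nat) (B : R) : (forall n, nm (u n : K) <= B) ->
  nm (limn u : K) <= B.
Proof.
move=> uB; have B0 : 0 <= B := le_trans (nm_ge0 (u 0%N : K)) (uB 0%N).
have [cu|ncu] := pselect (cvgn u); last first.
  by rewrite (dvgP ncu) /point /= nm0.
rewrite leNgt; apply/negP => lt.
have d0 : 0 < emb (nm (limn u : K) - B).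
  by rewrite emb_gt0 subr_gt0.
move/cvgrPdist_lt: (cu) => /(_ _ d0) [N _ /(_ N (leqnn N))] /=.
rewrite -nm_lt_emb => h.
have := nmD (limn u - u N : K) (u N); rewrite subrK => h2.
have := uB N; lra.
Qed.

(** An element g of X' is a bounded functional.  Otherwise there are vectors y_k of
norm at most 2^-k with nonnegative coordinates and sum |g| y_k > k; their sum
s converges in X and dominates every y_k, so g s is not summable. *)
Lemma kdual_bounded g : kdual (range c) g ->
  exists C : R, 0 <= C /\ forall x N, \sum_(i < N) nm (g i) * nm (coord x i) <= C * nm x.
Proof.
move=> gd; apply: contrapT => /forallNP H.
have step k : exists y : X, (nm y <= (2 ^+ k)^-1) /\
    exists a : nat -> R, [/\ forall i, 0 <= a i, forall i, coord y i = emb (a i)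
    & exists N, k%:R < \sum_(i < N) nm (g i) * a i].
  have C0 : 0 <= k%:R * 2 ^+ k :> R by rewrite mulr_ge0 ?exprn_ge0.
  have /not_andP [//|] := H (k%:R * 2 ^+ k).
  move=> /existsNP [x /existsNP [N /negP]]; rewrite -ltNge => lt.
  have p2 : 0 < 2 ^+ k :> R by rewrite exprn_gt0.
  have x0 : 0 < nm x.
    rewrite lt_def nm_ge0 andbT; apply/eqP => x0; move: lt.
    rewrite x0 mulr0 big1 ?ltxx // => i _.
    by rewrite (nm_eq0 x0) coord0 nm0 mulr0.
  pose l := (nm x)^-1 / 2 ^+ k; have l0 : 0 <= l.
    by rewrite mulr_ge0 ?invr_ge0 ?exprn_ge0 ?nm_ge0.
  pose a i := l * nm (coord x i).
  have a0 i : 0 <= a i by rewrite mulr_ge0 ?nm_ge0.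
  have al i : nm (emb (a i)) <= nm (coord (emb l *: x) i).
    by rewrite coordZ nmM (nm_emb l0) (nm_emb (a0 i)).
  have [y [cy ny]] := coord_ideal al.
  exists y; split.
    apply: (le_trans ny); rewrite nmZ nm_emb // /l mulrAC mulVf ?mul1r //.
    by rewrite gt_eqF.
  exists a; split=> //; exists N.
  rewrite /a; under eq_bigr do rewrite mulrCA.
  rewrite -mulr_sumr; apply: le_lt_trans (_ : l * (k%:R * 2 ^+ k * nm x) < _).
    rewrite le_eqVlt; apply/orP; left; apply/eqP; rewrite /l.
    by field; rewrite ?gt_eqF.
  by rewrite ltr_pM2l // /l mulr_gt0 ?invr_gt0.
have [y yP] := choice step; have [y1 y2] := all_and2 yP.
have [a aP] := choice y2; have [a0 ay aN] := all_and3 aP.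
pose S n := \sum_(k < n) y k.
have Sd n d : nm (S (n + d)%N - S n) <= 2 / 2 ^+ n - 2 / 2 ^+ (n + d).
  elim: d => [|d IH]; first by rewrite addn0 !subrr nm0.
  rewrite addnS /S big_ord_recr /= addrAC.
  apply: (le_trans (nmD _ _)).
  have := y1 (n + d)%N; rewrite exprS invfM mulrA divff ?mul1r //.
  by move: IH; rewrite /S; lra.
have cS : cvgn S.
  apply/cauchy_cvgP/cauchy_exP => eps eps0.
  have e0 := rho_gt0 eps0.
  have [n nE] : exists n, 2 / 2 ^+ n < rho eps.
    pose n := Num.bound (2 / rho eps); exists n.
    rewrite ltr_pdivrMr ?exprn_gt0 // mulrC -ltr_pdivrMr //.
    have : 2 / rho eps < n%:R by rewrite archi_boundP // divr_ge0 ?ltW.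
    move/lt_le_trans; apply; rewrite -natrX ler_nat ltnW //.
    exact: ltn_expl.
  exists (S n), n => // m /= nm'; rewrite -ball_normE /=.
  rewrite -normrN opprB -(emb_rho scalars (ltW eps0)) -nm_lt_emb.
  apply: le_lt_trans nE; have := Sd n (m - n)%N; rewrite subnKC // => /le_trans.
  by apply; rewrite lerBlDr lerDl divr_ge0 ?exprn_ge0.
pose s := limn S.
have sa k i : a k i <= nm (coord s i).
  rewrite leNgt; apply/negP => lt.
  have d0 : 0 < emb (a k i - nm (coord s i)).
    by rewrite emb_gt0 subr_gt0.
  move/cvgrPdist_lt: (cS) => /(_ _ d0) [N _ /(_ (N + k.+1)%N (leq_addr _ _))] /=.
  rewrite -nm_lt_emb => h.
  have h1 := nm_coord (s - S (N + k.+1)%N) i.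
  have h2 : nm (coord (S (N + k.+1)%N) i) <=
      nm (coord s i) + nm (coord (s - S (N + k.+1)%N) i).
    by rewrite -{1}(subKr (coord s i) (coord (S _) i)) -coordB; apply: nmB.
  have : a k i <= nm (coord (S (N + k.+1)%N) i).
    rewrite /S coord_sum; under eq_bigr do rewrite ay.
    rewrite -rmorph_sum nm_emb ?sumr_ge0 //.
    have kN : (k < N + k.+1)%N by rewrite addnS ltnS leq_addl.
    by rewrite (bigD1 (Ordinal kN)) //= lerDl sumr_ge0.
  by lra.
have /in_l1_bound [B BP] : in_l1 (fun n => g n * coord s n) by apply: gd; exists s.
have [N] := aN (Num.bound B).
apply/negP; rewrite -leNgt.
have B0 : 0 <= B by have := BP 0%N; rewrite big_ord0.
apply: (@le_trans _ _ B); last by rewrite ltW // archi_boundP.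
apply: le_trans (BP N); apply: ler_sum => i _.
by rewrite nmM ler_wpM2l ?nm_ge0.
Qed.

Lemma dot_le g N x : dual_ball g -> nm (dot N g x) <= nm x.
Proof.
move=> gd; apply: le_trans (gd x N); apply: (le_trans (nm_sum _ _ _)).
by apply: ler_sum => i _; rewrite nmM.
Qed.

Lemma dual_ball_le1 g i : dual_ball g -> nm (g i) <= 1.
Proof.
move=> /(_ (unit_vec i) i.+1);
  rewrite nm_unit big_ord_recr /= coord_unit eqxx nm1 mulr1.
by apply: le_trans; rewrite lerDr sumr_ge0 // => j _; rewrite mulr_ge0 ?nm_ge0.
Qed.

Lemma dotD g N x y : dot N g (x + y) = dot N g x + dot N g y.
Proof. by rewrite /dot -big_split; apply: eq_bigr => i _;
  rewrite coordD mulrDr. Qed.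

Lemma dotZ g N a x : dot N g (a *: x) = a * dot N g x.
Proof.
by rewrite /dot mulr_sumr; apply: eq_bigr => i _; rewrite coordZ mulrCA.
Qed.

Lemma dot_supported g N M x : supported N x -> (N <= M)%N -> dot M g x = dot N g x.
Proof.
move=> sx NM; rewrite /dot -!(big_mkord xpredT (fun i => g i * coord x i)).
rewrite (big_cat_nat (leq0n N) NM) //= [X in _ + X](_ : _ = 0) ?addr0 //.
rewrite big_nat_cond big1 // => i /andP[/andP[Ni _] _].
by rewrite sx ?mulr0.
Qed.

Lemma dot_truncate g N x : dot N g (truncate N x) = dot N g x.
Proof. by apply: eq_bigr => i _; rewrite coord_fin_vec ltn_ord. Qed.

(** An element g of the dual ball as defined through suprema is first seen to be
bounded, which makes the supremum meaningful; the absolute values are then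
obtained by testing g on x with its coordinates rotated by the signs of g. *)
Lemma kdual_ball_dual_ball g : kdual_ball (range c) (seq_ball c) g -> dual_ball g.
Proof.
move=> [gd g1]; have [C [C0 gC]] := kdual_bounded gd.
move=> x N; have [x0|x0] := eqVneq (nm x) 0.
  rewrite x0 big1 // => i _.
  by rewrite (nm_eq0 x0) coord0 nm0 mulr0.
have x_gt0 : 0 < nm x by rewrite lt_def x0 nm_ge0.
pose A := [set `|pairing f g| | f in seq_ball c]%classic.
have [||s [es us _]] := @supremum_lub A C.
- exists `|pairing (c 0) g|; exists (c 0) => //; exists 0 => //=.
  by rewrite normr0.
- move=> _ [_ [y /= y1 <-] <-]; split=> //; rewrite -nm_le_emb.
  apply: nm_limn => n; rewrite /series /= big_mkord.
  apply: (le_trans (nm_sum _ _ _)).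
  have y1' : nm y <= 1 by rewrite nm_le_emb rmorph1.
  apply: (@le_trans _ _ (C * nm y)); last by rewrite ler_piMr.
  apply: le_trans (gC y n); apply: ler_sum => i _.
  by rewrite nmM mulrC.
have s1 : s <= 1.
  rewrite -(emb_le scalars) rmorph1 -es; exact: g1.
pose y := (emb (nm x))^-1 *: fin_vec N (fun i => phase (g i) * `|coord x i|).
have y1 : nm y <= 1.
  rewrite /y -rmorphV ?unitfE // nmZ nm_emb ?invr_ge0 ?nm_ge0 //.
  rewrite mulrC ler_pdivrMr // mul1r; apply: le_fin_vec => i _.
  by rewrite nmM nm_phase mul1r nm_nm.
have pE : pairing (c y) g =
    emb ((nm x)^-1 * \sum_(i < N) nm (g i) * nm (coord x i)).
  rewrite /pairing (@limn_finite_support _ N); last first.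
    move=> i Ni; rewrite -/(coord y i) coordZ coord_fin_vec ltnNge Ni /=.
    by rewrite mulr0 mul0r.
  rewrite rmorphM rmorph_sum fmorphV /= mulr_sumr; apply: eq_bigr => i _.
  rewrite -/(coord y i) coordZ coord_fin_vec ltn_ord rmorphM /= !nmE -(mul_phase (g i)).
  ring.
have : rho `|pairing (c y) g| <= s.
  apply: us; exists (c y) => //; exists y => //=.
  by rewrite -(rmorph1 emb) -nm_le_emb.
rewrite pE nm_emb; last first.
  by rewrite mulr_ge0 ?invr_ge0 ?nm_ge0 // sumr_ge0 // => i _;
    rewrite mulr_ge0 ?nm_ge0.
by rewrite mulrC ler_pdivrMr // => /le_trans; apply; rewrite ler_piMl ?nm_ge0.
Qed.

Lemma kdual_ball0 : kdual_ball (range c) (seq_ball c) (fun=> 0).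
Proof.
split.
  move=> f _; apply: (@bound_in_l1 _ 0) => N; rewrite big1 // => i _.
  by rewrite mul0r nm0.
have p0 h : pairing h (fun=> 0) = 0 :> K.
  rewrite /pairing (@limn_finite_support _ 0%N) ?big_ord0 // => i _.
  by rewrite mulr0.
pose A := [set `|pairing f (fun=> 0)| | f in seq_ball c]%classic.
have [||s [es _ /(_ 1 ltr01)]] := @supremum_lub A 0.
- by exists `|pairing (c 0) (fun=> 0)|; exists (c 0) => //; exists 0;
  rewrite //= normr0.
- by move=> _ [h _ <-]; rewrite p0 normr0 rmorph0 lexx.
case=> _ [h _ <-]; rewrite p0 nm0 subr_lt0 => s1.
by rewrite /kdual_norm es -(rmorph1 emb) (emb_le scalars) ltW.
Qed.

(** X' is norming.  The pairing is an infinite sum, whence the threshold N0. *)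
Lemma norming x eps : 0 < eps -> exists g, dual_ball g /\
  exists N0, forall N, (N0 <= N)%N -> nm x - eps <= nm (dot N g x).
Proof.
move=> eps0; have [xe|ex] := leP (nm x) eps.
  exists (fun=> 0); split.
    by move=> y N; rewrite big1 ?nm_ge0 // => i _; rewrite nm0 mul0r.
  exists 0%N => N _; apply: le_trans (nm_ge0 _); lra.
pose A := [set `|pairing f (c x)| | f in kdual_ball (range c) (seq_ball c)]%classic.
have [||s [es us As]] := @supremum_lub A (nm x).
- by exists `|pairing (fun=> 0) (c x)|; exists (fun=> 0) => //; exact: kdual_ball0.
- move=> _ [f /kdual_ball_dual_ball fd <-]; split=> //; rewrite -nm_le_emb.
  apply: nm_limn => n; rewrite /series /= big_mkord.
  exact: (dot_le n x fd).
have sx : s = nm x.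
  apply: emb_inj; rewrite nmE (ri_norming X_ri x) -es //.
have [_ [f fd <-] lt] := As _ eps0.
have {}fd := kdual_ball_dual_ball fd.
exists f; split=> //.
have cu : cvgn (series (fun n => f n * c x n) : (K^o)^nat).
  apply: contrapT => ncu; move: lt; rewrite /pairing (dvgP ncu) /point /= nm0.
  by lra.
have d0 : 0 < emb (rho `|pairing f (c x)| - (s - eps)).
  by rewrite emb_gt0 subr_gt0.
move/cvgrPdist_lt: (cu) => /(_ _ d0) [N0 _ N0P].
exists N0 => N /N0P /=; rewrite -nm_lt_emb -/(pairing _ _).
rewrite /series /= big_mkord -/(dot N f x) => h.
have := nmD (pairing f (c x) - dot N f x) (dot N f x); rewrite subrK => h2.
by rewrite -sx; lra.
Qed.

(** The weak Fatou property: a functional that almost norms x almost norms its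
long truncations. *)
Lemma fatou x eps : 0 < eps ->
  exists N0, forall N, (N0 <= N)%N -> nm x - eps <= nm (truncate N x).
Proof.
move=> /(norming x) [g [gd [N0 gN]]]; exists N0 => N NN.
by apply: (le_trans (gN _ NN)); rewrite -dot_truncate dot_le.
Qed.

Lemma norming_supported x N eps : supported N x -> 0 < eps ->
    exists g, dual_ball g /\
  forall M, (N <= M)%N -> nm x - eps <= nm (dot M g x).
Proof.
move=> sx /(norming x) [g [gd [N0 gN]]]; exists g; split=> // M NM.
rewrite (dot_supported _ sx NM) -(dot_supported _ sx (leq_maxr N0 N)).
by apply: gN; apply: leq_maxl.
Qed.

(** * Rearrangements and the fundamental function *)

Lemma nm_rearrange tau tauV x y N : cancel tau tauV -> cancel tauV tau ->
  supported N x -> (forall i, coord y i = coord x (tauV i)) -> nm x = nm y.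
Proof.
move=> tk kt sx yx; have [l1x _] := finite_support_l1 sx.
have [_ /(_ x y erefl) h] := ri_rearrange X_ri tk kt l1x.
by rewrite h //; apply/funext => i; apply: yx.
Qed.

Definition block (s : seq nat) : X := \sum_(i <- s) unit_vec i.

Definition fundamental m := nm (block (iota 0 m)).

Lemma coord_block s j : uniq s -> coord (block s) j = (j \in s)%:R.
Proof.
rewrite /block coord_sum; elim: s => [|a s IH] /=; first by rewrite big_nil.
case/andP=> as_ us; rewrite big_cons IH // coord_unit in_cons.
by case: eqP => [->|_]; rewrite ?(negPf as_) ?addr0 ?add0r.
Qed.

Lemma supported_block s N : (forall i, i \in s -> (i < N)%N) ->
    supported N (block s).
Proof.
move=> sN i Ni; rewrite coord_sum big_seq big1 // => j js;
  rewrite coord_unit gtn_eqF //.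
exact: leq_trans (sN _ js) Ni.
Qed.

(** A permutation of an initial segment of the integers, the identity beyond
it, moves s onto an initial segment. *)
Lemma nm_block s : uniq s -> nm (block s) = fundamental (size s).
Proof.
move=> us; pose M := (\max_(i <- s) i).+1.
have sM : forall i, i \in s -> (i < M)%N := @lt_bigmax s.
pose s' := s ++ [seq i <- iota 0 M | i \notin s].
have us' : uniq s'.
  rewrite cat_uniq us filter_uniq ?iota_uniq // andbT -all_predC.
  by apply/allP => i; rewrite mem_filter => /andP[].
have ps' : perm_eq s' (iota 0 M).
  apply: uniq_perm => // [|i]; first exact: iota_uniq.
  rewrite mem_cat mem_filter mem_iota add0n /=.
  by case: (boolP (i \in s)) => [/sM ->|].
have szs' : size s' = M by rewrite (perm_size ps') size_iota.
have ms' i : (i \in s') = (i < M)%N by rewrite (perm_mem ps') mem_iota.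
have szs : (size s <= M)%N by rewrite -szs' size_cat leq_addr.
pose tau n := if (n < M)%N then nth 0%N s' n else n.
pose tauV n := if (n < M)%N then index n s' else n.
have tk : cancel tau tauV.
  move=> n; rewrite /tau /tauV; have [nM|/negbTE Mn] := boolP (n < M)%N;
    last by rewrite !Mn.
  by rewrite -ms' mem_nth ?szs' // index_uniq ?szs'.
have kt : cancel tauV tau.
  move=> n; rewrite /tau /tauV; have [nM|/negbTE Mn] := boolP (n < M)%N;
    last by rewrite !Mn.
  by rewrite -{1}szs' index_mem ms' nM nth_index ?ms'.
apply: (nm_rearrange kt tk (supported_block sM)) => i.
rewrite !coord_block ?iota_uniq // mem_iota add0n /=; congr (_%:R);
  congr nat_of_bool.
apply/esym; rewrite /tau; have [iM|Mi] := ltnP i M.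
  rewrite nth_cat; have [is_|si] := ltnP i (size s); first by rewrite mem_nth.
  apply/negbTE.
  have : nth 0%N [seq i0 <- iota 0 M | i0 \notin s] (i - size s)
     \in [seq i0 <- iota 0 M | i0 \notin s].
    by apply: mem_nth; rewrite ltn_subLR // -size_cat szs'.
  by rewrite mem_filter => /andP[].
rewrite ltnNge (leq_trans szs Mi) /=; apply/negbTE/negP => /sM.
by rewrite ltnNge Mi.
Qed.

Lemma dual_ball_seq g s x : dual_ball g -> uniq s ->
  \sum_(i <- s) nm (g i) * nm (coord x i) <= nm x.
Proof.
move=> gd us; pose M := (\max_(i <- s) i).+1.
apply: le_trans (gd x M).
rewrite -(big_mkord xpredT (fun i => nm (g i) * nm (coord x i))).
rewrite [X in _ <= X](bigID (mem s)) /=.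
rewrite -[X in _ <= X + _]big_filter.
rewrite (perm_big [seq i <- index_iota 0 M | i \in s]); last first.
  apply: uniq_perm => // [|i]; first by rewrite filter_uniq ?iota_uniq.
  rewrite mem_filter mem_index_iota /=; case: (boolP (i \in s)) => //= si.
  by apply/esym/lt_bigmax.
by rewrite lerDl sumr_ge0 // => i _; rewrite mulr_ge0 ?nm_ge0.
Qed.

Lemma dual_ball_sum g s : dual_ball g -> uniq s ->
    \sum_(i <- s) nm (g i) <= fundamental (size s).
Proof.
move=> gd us; rewrite -nm_block //; apply: le_trans (dual_ball_seq (block s) gd us).
rewrite le_eqVlt; apply/orP; left; apply/eqP; apply: eq_big_seq => i si.
by rewrite coord_block // si nm1 mulr1.
Qed.

Lemma dual_ball_initial m g : dual_ball g -> \sum_(i < m) nm (g i) <= fundamental m.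
Proof.
move=> gd; have := dual_ball_sum gd (iota_uniq 0 m); rewrite size_iota.
by rewrite -(big_mkord xpredT (fun i => nm (g i))) /index_iota subn0.
Qed.

Lemma dot_unit g N i : (i < N)%N -> dot N g (unit_vec i) = g i.
Proof.
move=> iN; rewrite /dot (bigD1 (Ordinal iN)) //= coord_unit eqxx mulr1 big1 ?addr0 // => j.
by rewrite -val_eqE /= coord_unit => /negPf ->; rewrite mulr0.
Qed.

Lemma dot_delta N j z : (j < N)%N -> dot N (fun i => (i == j)%:R) z = coord z j.
Proof.
move=> jN; rewrite /dot (bigD1 (Ordinal jN)) //= eqxx mul1r big1 ?addr0 // => i.
by rewrite -val_eqE /= => /negPf ->; rewrite mul0r.
Qed.

Lemma dot_block g N (s : seq nat) : (forall i, i \in s -> (i < N)%N) ->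
  dot N g (block s) = \sum_(i <- s) g i.
Proof.
move=> sN; rewrite /block.
have pr0 : dot N g 0 = 0 by rewrite /dot big1 // => i _; rewrite coord0 mulr0.
rewrite (big_morph (dot N g) (dotD g N) pr0).
by apply: eq_big_seq => i /sN; apply: dot_unit.
Qed.

(** If phi(m) is at least m for m = [size s], then an almost norming functional of
[block s] has m coordinates of modulus at most 1 with sum almost m, so all of
them are almost of modulus 1. *)
Lemma block_coords s x : uniq s -> (size s)%:R <= fundamental (size s) ->
  \sum_(i <- s) nm (coord x i) <= nm x.
Proof.
move=> us ss; apply: (@le_of_le_add R _ _ (nm x)); first exact: nm_ge0.
move=> eps eps0; pose M := (\max_(i <- s) i).+1.
have sM : forall i, i \in s -> (i < M)%N := @lt_bigmax s.
have [g [gd /(_ M (leqnn M))]] := norming_supported (supported_block sM) eps0.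
rewrite dot_block // nm_block // => h.
have gs : (size s)%:R - eps <= \sum_(i <- s) nm (g i).
  by have := nm_sum s xpredT g; lra.
have -> : \sum_(i <- s) nm (coord x i) = \sum_(i <- s) nm (g i) * nm (coord x i) +
    \sum_(i <- s) (1 - nm (g i)) * nm (coord x i).
  by rewrite -big_split /=; apply: eq_bigr => i _; ring.
apply: lerD; first exact: dual_ball_seq.
apply: (@le_trans _ _ (\sum_(i <- s) (1 - nm (g i)) * nm x)).
  by apply: ler_sum => i _; rewrite ler_wpM2l ?nm_coord // subr_ge0 dual_ball_le1.
rewrite -mulr_suml ler_wpM2r ?nm_ge0 // sumrB.
by rewrite big_const_seq count_predT iter_addr_0 -[1 *+ _]/((size s)%:R); lra.
Qed.

(** * Using the alternative Daugavet property *)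

Hypothesis ADP : alternative_Daugavet X.

Definition rank1 k (h : nat -> K) (u : X) (z : X) : X := dot k h z *: u.

Lemma rank1_linear k h u : linear (rank1 k h u).
Proof. by move=> a x y; rewrite /rank1 dotD dotZ scalerDl scalerA. Qed.

(** With s the norm of the functional h, the property yields y in the unit ball
with w = y + theta h(y) u of norm almost 1 + s.  Since |h(y)| <= s, both bounds
|h(y)| >= s and, for g almost norming w, |g(y)| = |g(u)| = 1 hold up to small
errors.  Truncating y keeps everything finitely supported, and [u'] is the
normalized truncation of w. *)
Lemma adp_step k h m u eps : supported m u -> nm u = 1 -> 0 < eps ->
  exists N y u' eps', (m <= N)%N /\ [/\ supported N y, supported N u', nm y <= 1, nm u' = 1
   & 0 < eps'] /\
    (forall z, nm z <= 1 -> nm (dot k h z) - eps <= nm (dot k h y)) /\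
    (forall g, dual_ball g -> 1 - eps' <= nm (dot N g u') ->
      1 - eps <= nm (dot N g u) /\ 1 - eps <= nm (dot N g y)).
Proof.
move=> su u1 eps0.
have [h0|/existsNP [i /not_implyP [ik /eqP hi]]] :=
    pselect (forall i, (i < k)%N -> h i = 0).
  exists m, u, u, eps; split=> //; split; first by split; rewrite ?u1.
  split=> //.
  move=> z _; rewrite /dot !big1; last first.
  - by move=> i _; rewrite h0 ?mul0r.
  - by move=> i _; rewrite h0 ?mul0r.
  by rewrite nm0; lra.
pose T : {linear X -> X} := HB.pack (rank1 k h u)
  (GRing.isLinear.Build _ _ _ _ _ (rank1_linear k h u)).
pose C := \sum_(i < k) nm (h i).
have nmT z : nm (T z) = nm (dot k h z) by rewrite /= /rank1 nmZ u1 mulr1.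
have TC z : nm (T z) <= C * nm z.
  rewrite nmT /dot /C mulr_suml; apply: (le_trans (nm_sum _ _ _)).
  by apply: ler_sum => j _; rewrite nmM ler_wpM2l ?nm_ge0 ?nm_coord.
have C0 : 0 <= C by rewrite sumr_ge0 // => j _; apply: nm_ge0.
have bT : bounded_operator T.
  by exists (emb C) => z; rewrite -(nmE z) -rmorphM -nm_le_emb.
have u0 : u != 0.
  by apply/eqP => u0; move: u1; rewrite u0 nm0 => /eqP; rewrite eq_sym oner_eq0.
have pre : dot k h (unit_vec i) = h i by apply: dot_unit.
have rT : rank_one T.
  exists u => //; apply/seteqP; split=> _ [a _ <-].
    by exists (dot k h a).
  by exists ((a / h i) *: unit_vec i) => //=; rewrite /rank1 dotZ pre divfK.
have [[th th1 E] _] := ADP bT rT.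
have [||s [es us _]] :=
    @supremum_lub [set `|T x| | x in [set x | `|x| <= 1]]%classic C.
- by exists `|T 0|; exists 0; rewrite //= normr0.
- move=> _ [x /= x1 <-]; split=> //; rewrite -nm_le_emb.
  apply: (le_trans (TC x)); rewrite ler_piMr //.
  by rewrite nm_le_emb rmorph1.
have us' z : nm z <= 1 -> nm (dot k h z) <= s.
  move=> z1; rewrite -nmT; apply: us; exists z => //=.
  by rewrite -(rmorph1 emb) -nm_le_emb.
have s0 : 0 < s.
  apply: lt_le_trans (us' (unit_vec i) _);
    rewrite ?nm_unit // pre lt_def nm_ge0 andbT.
  by apply: contraNneq hi => /nm_eq0 ->.
have th1' : nm th = 1.
  by apply: emb_inj; rewrite nmE th1 rmorph1.
(* The allowed error: small compared with eps, with s and with eps * s, since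
   the estimate for |g(u)| is obtained after multiplication by s. *)
pose kap := eps * s / (4 * (1 + s) * (1 + eps)).
have s1 : 0 < 1 + s by rewrite addr_gt0.
have e1 : 0 < 1 + eps by rewrite addr_gt0.
have kapE : 4 * kap * ((1 + s) * (1 + eps)) = eps * s.
  by rewrite /kap; field; rewrite !gt_eqF.
have kap0 : 0 < kap by rewrite /kap divr_gt0 ?mulr_gt0.
have kap_s : 4 * kap <= s.
  rewrite -(ler_pM2r e1); apply: (@le_trans _ _ (eps * s)); last by nra.
  by rewrite -kapE; nra.
have k1 : 4 * kap <= eps * s by rewrite -kapE; nra.
have k2 : 4 * kap <= eps.
  rewrite -(ler_pM2r s1); apply: (@le_trans _ _ (eps * s)); last by nra.
  by rewrite -kapE; nra.
have [||s' [es' _ As']] := @supremum_lub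
    [set `|x + th *: T x| | x in [set x | `|x| <= 1]]%classic (1 + C).
- by exists `|0 + th *: T 0|; exists 0; rewrite //= normr0.
- move=> _ [x /= x1 <-]; split=> //; rewrite -nm_le_emb.
  have x1' : nm x <= 1 by rewrite nm_le_emb rmorph1.
  apply: (le_trans (nmD _ _)); rewrite nmZ th1' mul1r lerD //.
  by apply: (le_trans (TC x)); rewrite ler_piMr.
have ss : s' = 1 + s.
  by apply: emb_inj; rewrite rmorphD rmorph1 /= -es' -es.
have [_ [y y1 <-] lt] := As' _ kap0; rewrite {}ss in lt.
have {}y1 : nm y <= 1 by rewrite nm_le_emb rmorph1.
pose a := dot k h y; have as_ : nm a <= s by apply: us'.
pose w := y + (th * a) *: u.
have wE : y + th *: T y = w by rewrite /w /= /rank1 scalerA.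
rewrite wE in lt.
have wa : nm w <= nm y + nm a.
  by apply: (le_trans (nmD _ _)); rewrite nmZ u1 mulr1 nmM th1' mul1r.
have [N0 N0P] := fatou w kap0.
pose N := maxn N0 (maxn m k).
have mN : (m <= N)%N by rewrite !leq_max leqnn orbT.
have kN : (k <= N)%N by rewrite !leq_max leqnn !orbT.
have wN : nm w - kap <= nm (truncate N w) by apply: N0P; apply: leq_maxl.
have suN := supported_le mN su.
have trw : truncate N w = truncate N y + (th * a) *: u.
  apply: coord_inj => j; rewrite coordD coordZ !coord_fin_vec coordD coordZ;
    case: ltnP => // Nj.
  by rewrite suN ?mulr0 ?addr0.
have pry : dot k h (truncate N y) = a.
  apply: eq_bigr => j _; rewrite coord_fin_vec.
  by rewrite (leq_trans (ltn_ord j) kN).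
exists N, (truncate N y), ((emb (nm (truncate N w)))^-1 *: truncate N w), (kap / (1 + s)).
have w0 : 0 < nm (truncate N w) by lra.
split=> //; split; first split.
- exact: supported_fin_vec.
- by move=> j Nj; rewrite coordZ supported_fin_vec // mulr0.
- exact: le_trans (nm_truncate _ _) y1.
- rewrite -rmorphV ?unitfE ?gt_eqF // nmZ nm_emb ?invr_ge0 ?nm_ge0 //.
  by rewrite mulVf // gt_eqF.
- by rewrite divr_gt0.
split; first by move=> z /us' zs; rewrite pry; lra.
move=> g gd;
  rewrite dotZ -rmorphV ?unitfE ?gt_eqF // nmM nm_emb ?invr_ge0 ?nm_ge0 //.
rewrite (mulrC (nm _)^-1) ler_pdivlMr // trw dotD dotZ => gw.
have P1 : nm (dot N g (truncate N y)) <= 1.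
  by apply: le_trans (dot_le _ _ gd) _; apply: le_trans (nm_truncate _ _) y1.
have Q1 : nm (dot N g u) <= 1 by rewrite -u1 dot_le.
have := nmD (dot N g (truncate N y)) (th * a * dot N g u).
rewrite !nmM th1' mul1r; move: gw; rewrite trw in wN.
set P := nm (dot N g (truncate N y)) in P1 *; set Q := nm (dot N g u) in Q1 *.
set W := nm _ in wN *; set G := nm _ => g1 g2.
have Q0 : 0 <= Q := nm_ge0 _.
have aQ : nm a * Q <= s * Q by rewrite ler_wpM2r.
have kk : (1 + s) * (kap / (1 + s)) = kap by rewrite mulrC divfK // gt_eqF.
have k0 : 0 < kap / (1 + s) by rewrite divr_gt0.
have k3 : kap / (1 + s) <= 1 by rewrite ler_pdivrMr // mul1r; lra.
have W1 : 1 + s - 2 * kap <= W by lra.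
have W2 : 1 + s - 3 * kap <= P + s * Q.
  apply: (@le_trans _ _ ((1 - kap / (1 + s)) * W)); last by lra.
  apply: (@le_trans _ _ ((1 - kap / (1 + s)) * (1 + s - 2 * kap))).
    by move: kk k0; set q := kap / (1 + s) => kk k0; nra.
  by rewrite ler_wpM2l // subr_ge0.
have Qe : s * (1 - eps) <= s * Q by lra.
split; last by nra.
by rewrite -(ler_pM2l s0).
Qed.

(** Iteration of [adp_step], the new unit vector taking over the role of u and its
tolerance that of eps at each stage; a functional that almost norms the last
vector almost norms all the earlier ones. *)
Lemma adp_list n k (hs : nat -> nat -> K) m u eps :
  supported m u -> nm u = 1 -> 0 < eps ->
  exists N (ys : nat -> X) u' eps', (m <= N)%N /\
    [/\ supported N u', nm u' = 1 & 0 < eps'] /\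
    (forall j, (j < n)%N -> [/\ supported N (ys j), nm (ys j) <= 1 &
       forall z, nm z <= 1 ->
         nm (dot k (hs j) z) - eps <= nm (dot k (hs j) (ys j))]) /\
    (forall g, dual_ball g -> 1 - eps' <= nm (dot N g u') ->
      1 - eps <= nm (dot N g u) /\
      forall j, (j < n)%N -> 1 - eps <= nm (dot N g (ys j))).
Proof.
move=> su u1 eps0; elim: n => [|n [N1 [ys [u1' [eps1 [mN1]]]]]].
  by exists m, (fun=> 0), u, eps; split=> //; split=> //; split.
case=> -[su1 u11 eps10] [ysP gP].
have d0 : 0 < Num.min eps eps1 by rewrite lt_min eps0.
have [N2 [y [u2 [eps2 [N12 [[sy su2 y1 u21 eps20] [yP gP2]]]]]]] :=
  adp_step k (hs n) su1 u11 d0.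
exists N2, (fun j => if j == n then y else ys j), u2, eps2.
split; first exact: leq_trans N12.
split; first by split.
split=> [j|g gd gu].
  rewrite ltnS leq_eqVlt; case: eqP => [-> _|_ /= jn].
    split=> // z /yP; apply: le_trans; rewrite lerB // ge_min lexx //.
  by have [syj yj1 yjP] := ysP _ jn; split=> //; apply: supported_le syj.
have [g1 g2] := gP2 _ gd gu.
have {}g1 : 1 - eps1 <= nm (dot N1 g u1').
  by rewrite -(dot_supported _ su1 N12); apply: le_trans g1;
    rewrite lerB // ge_min lexx orbT.
have [gu1 gys] := gP _ gd g1.
split; first
    by rewrite (dot_supported _ su (leq_trans mN1 N12)) -(dot_supported _ su mN1).
move=> j; rewrite ltnS leq_eqVlt; case: eqP => [_ _|_ /= jn].
  by apply: le_trans g2; rewrite lerB // ge_min lexx.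
have [syj _ _] := ysP _ jn.
by rewrite (dot_supported _ syj N12); apply: gys.
Qed.


(** * Norming functionals with coordinates near 0 or 1 *)

(** Two rounds of [adp_list].  The first one treats the coordinate functionals and
gives y_i with |y_i(i)| = 1 = |g(y_i)|, hence sum_(j != i) |g_j| |y_i(j)| >= 1 -
t where t = |g_i| (all up to errors).  The sequence y_i, with suitably rotated
coordinates, shows that h = om e_i - sum_(j != i) g_j e_j, where g_i = t om, has
norm at least 2 - t.  The second round treats a net containing an approximation
of h, and gives y2 with |h(y2)| >= 2 - t and |g(y2)| = 1, so that
[zero_one_scalar] applies to v = om y2(i), q the rest of g(y2) on the first N
coordinates, and r its remainder. *)
Lemma zero_one_norming M u eps : supported M u -> nm u = 1 -> 0 < eps <= 1 ->
  exists g, [/\ dual_ball g, 1 - eps <= nm (dot M g u) &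
    forall i, (i < M)%N -> nm (g i) <= eps \/ 1 - eps <= nm (g i)].
Proof.
move=> su u1 /andP[eps0 eps1]; pose d := eps ^+ 3 / 16.
have d0 : 0 < d by rewrite divr_gt0 ?exprn_gt0.
have de : d <= eps.
  have : eps ^+ 3 <= eps by rewrite exprS ler_piMr ?(ltW eps0) // expr_le1 // ltW.
  by rewrite /d; lra.
have [N [ys [u' [e1 [MN [[su' u'1 e10] [ysP gP]]]]]]] :=
  adp_list M M (fun j i => (i == j)%:R) su u1 d0.
have ysj j : (j < M)%N -> 1 - d <= nm (coord (ys j) j).
  move=> jM; have [_ _ /(_ (unit_vec j))] := ysP _ jM.
  by rewrite !dot_delta // coord_unit eqxx nm1 nm_unit; apply.
have [n nN] : exists n : nat, n.+1%:R^-1 * N%:R <= d.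
  (* The mesh of the net is fine enough for the sum of N coordinate errors. *)
  exists (Num.bound (N%:R / d)).
  rewrite mulrC ler_pdivrMr ?ltr0n // mulrC -ler_pdivrMr //.
  apply: (@le_trans _ _ (Num.bound (N%:R / d))%:R); last by rewrite ler_nat.
  by rewrite ltW // archi_boundP // divr_ge0 ?ler0n ?(ltW d0).
have [L LP] := disc_net scalars n.
have m0 : 0 < Num.min d e1 by rewrite lt_min d0.
have [N2 [ys2 [u2 [e2 [NN2 [[su2 u21 e20] [ys2P g2P]]]]]]] :=
  adp_list (size (words L N)) N (fun j i => nth 0 (nth [::] (words L N) j) i)
    su' u'1 m0.
have [g [gd /(_ N2 (leqnn N2))]] := norming_supported su2 e20; rewrite u21 => gu2.
have [gu' gys2] := g2P _ gd gu2.
have {}gu' : 1 - e1 <= nm (dot N g u').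
  rewrite -(dot_supported g su' NN2); apply: le_trans gu'.
  by rewrite lerB // ge_min lexx orbT.
have [gu gys] := gP _ gd gu'.
exists g; split=> //.
  by rewrite -(dot_supported g su MN); apply: le_trans gu; rewrite lerB.
move=> i iM; have iN := leq_trans iM MN.
pose om := (phase (g i))^-1.
have om1 : nm om = 1.
  by apply: emb_inj; rewrite nmE normfV norm_phase invr1 rmorph1.
have gom : g i = emb (nm (g i)) * om.
  rewrite nmE -mul_phase /om mulfK //; apply/eqP => p0.
  by have := nm_phase (g i); rewrite p0 nm0 => /eqP; rewrite eq_sym oner_eq0.
pose h j := if j == i then om else - g j.
have h1 j : nm (h j) <= 1.
  by rewrite /h; case: eqP => _; [rewrite om1|rewrite nmN dual_ball_le1].
(* f is a point of the net close to h; it is the word number j0. *)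
have /choice [f fP] : forall j, exists w, w \in L /\ nm (h j - w) < n.+1%:R^-1.
  move=> j; have [|w wL hw] := LP (h j); last by exists w.
  by rewrite -(rmorph1 emb) -nm_le_emb.
have [fL fh] := all_and2 fP.
pose j0 := index (mkseq f N) (words L N).
have j0P : (j0 < size (words L N))%N by rewrite index_mem mem_words.
have [sy2 y21 sharp] := ys2P _ j0P; have gy2 := gys2 _ j0P.
move: sy2 y21 sharp gy2; set y2 := ys2 j0 => sy2 y21 sharp gy2.
pose w j := nth 0 (nth [::] (words L N) j0) j.
have wf j : (j < N)%N -> w j = f j.
  by move=> jN; rewrite /w nth_index ?mem_words // nth_mkseq.
have near_h z : nm z <= 1 -> nm (dot N w z - dot N h z) <= d.
  move=> z1; apply: le_trans nN.
  rewrite /dot -sumrB; apply: (le_trans (nm_sum _ _ _)).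
  apply: (@le_trans _ _ (\sum_(j < N) n.+1%:R^-1)).
    apply: ler_sum => j _; rewrite wf // -mulrBl nmM -nmN opprB.
    rewrite -[X in _ <= X]mulr1; apply: ler_pM; rewrite ?nm_ge0 ?(ltW (fh _)) //.
    exact: le_trans (nm_coord _ _) z1.
  by rewrite sumr_const card_ord mulr_natr.
have sharp_h z : nm z <= 1 -> nm (dot N h z) - 3 * d <= nm (dot N h y2).
  move=> z1; have s1 := sharp _ z1.
  have n1 := near_h _ z1; have n2 := near_h _ y21.
  have t1 := nmB (dot N w z) (dot N w z - dot N h z); rewrite subKr in t1.
  have t2 := nmD (dot N w y2 - dot N h y2) (dot N h y2); rewrite subrK in t2.
  have md : Num.min d e1 <= d by rewrite ge_min lexx.
  rewrite -/w in s1; lra.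
have [_ yi1 _] := ysP _ iM.
have yid := ysj _ iM.
have gyi := gys _ iM.
move: yi1 yid gyi; set y := ys i => yi1 yid gyi.
pose z := fin_vec N (fun j => phase (h j) * `|coord y j|).
have z1 : nm z <= 1.
  apply: le_trans yi1; apply: le_fin_vec => j _.
  by rewrite nmM nm_phase mul1r nm_nm.
have prz : nm (dot N h z) = \sum_(j < N) nm (h j) * nm (coord y j).
  have -> : dot N h z = emb (\sum_(j < N) nm (h j) * nm (coord y j)).
    rewrite rmorph_sum; apply: eq_bigr => j _.
    by rewrite coord_fin_vec ltn_ord mulrA mul_phase rmorphM /= !nmE.
  by rewrite nm_emb // sumr_ge0 // => j _; rewrite mulr_ge0 ?nm_ge0.
pose io := Ordinal iN.
have hE : \sum_(j < N) nm (h j) * nm (coord y j) = nm (coord y i) +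
    \sum_(j < N | j != io) nm (g j) * nm (coord y j).
  rewrite (bigD1 io) //= {1}/h eqxx om1 mul1r; congr (_ + _).
  by apply: eq_bigr => j; rewrite -val_eqE /= /h => /negPf ->; rewrite nmN.
pose t := nm (g i).
have t01 : 0 <= t <= 1 by rewrite /t nm_ge0 dual_ball_le1.
have zlow : 2 - t - 2 * d <= nm (dot N h z).
  have : nm (dot N g y) <= t * nm (coord y i) + \sum_(j < N | j != io) nm (g j) * nm (coord y j).
    apply: (le_trans (nm_sum _ _ _)); rewrite (bigD1 io) //= nmM lerD2l.
    by apply: ler_sum => j _; rewrite nmM.
  rewrite prz hE => gy; move/andP: t01 => [t0 t1].
  have yn1 := le_trans (nm_coord y i) yi1.
  have : (1 - t) * (1 - d) <= (1 - t) * nm (coord y i)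
      by rewrite ler_wpM2l ?subr_ge0.
  nra.
have hlow := sharp_h _ z1.
pose q := \sum_(j < N | j != io) g j * coord y2 j.
pose r := \sum_(N <= j < N2) g j * coord y2 j.
have hy2 : dot N h y2 = om * coord y2 i - q.
  rewrite /dot (bigD1 io) //= {1}/h eqxx; congr (_ + _).
  rewrite /q -sumrN; apply: eq_bigr => j; rewrite -val_eqE /= /h => /negPf ->.
  by rewrite mulNr.
have gy2E : dot N2 g y2 = emb t * (om * coord y2 i) + q + r.
  by rewrite /dot (sum_ord_cat (fun i => g i * coord y2 i) NN2) (bigD1 io) //= mulrA -gom.
have sum1 : t * nm (om * coord y2 i) + nm q + nm r <= 1.
  apply: le_trans y21; apply: le_trans (gd y2 N2).
  rewrite (sum_ord_cat (fun i => nm (g i) * nm (coord y2 i)) NN2) (bigD1 io) //=.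
  rewrite nmM om1 mul1r; apply: lerD; first apply: lerD => //.
    by apply: (le_trans (nm_sum _ _ _)); apply: ler_sum => j _; rewrite nmM.
  by apply: (le_trans (nm_sum _ _ _)); apply: ler_sum => j _; rewrite nmM.
apply: (@zero_one_scalar t eps (om * coord y2 i) q r (nm_ge0 _)) => //.
- by rewrite eps0.
- by rewrite nmM om1 mul1r (le_trans (nm_coord _ _)).
- by rewrite -hy2 -/d; lra.
- rewrite -gy2E -/d; apply: le_trans gy2.
  by rewrite lerB // ge_min lexx.
Qed.

(** * The fundamental function *)

(** Otherwise take g from [zero_one_norming] for the normalized indicator of M
points.  If more than k of its coordinates are almost of modulus 1, then
phi(k+1) is almost k+1; if at most k are, the others being small, then phi(M) is
almost at most k. *)
Lemma fundamental_bounded k M : fundamental k.+1 < k.+1%:R -> fundamental M <= k%:R.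
Proof.
move=> pk; rewrite leNgt; apply/negP => kM.
have p0 : 0 < fundamental M by apply: le_lt_trans kM.
pose a := k.+1%:R - fundamental k.+1; pose b := fundamental M - k%:R.
have a0 : 0 < a by rewrite subr_gt0.
have b0 : 0 < b by rewrite subr_gt0.
pose eps : R :=
    Num.min 1 (Num.min (a / (2 * k.+1%:R)) (b / (2 * (fundamental M + M%:R)))).
have pM : 0 < fundamental M + M%:R by rewrite ltr_wpDr.
have eps0 : 0 < eps by rewrite !lt_min ltr01 !divr_gt0 ?mulr_gt0 ?ltr0n.
have eps1 : eps <= 1 by rewrite ge_min lexx.
have epsa : eps * (2 * k.+1%:R) <= a.
  by rewrite -ler_pdivlMr ?mulr_gt0 ?ltr0n // !ge_min lexx orbT.
have epsb : eps * (2 * (fundamental M + M%:R)) <= b.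
  by rewrite -ler_pdivlMr ?mulr_gt0 // !ge_min lexx !orbT.
have sM i : i \in iota 0 M -> (i < M)%N by rewrite mem_iota.
pose u := (emb (fundamental M))^-1 *: block (iota 0 M).
have su : supported M u.
  by move=> i Mi; rewrite coordZ (supported_block sM Mi) mulr0.
have u1 : nm u = 1.
  rewrite /u -rmorphV ?unitfE ?gt_eqF // nmZ nm_emb ?invr_ge0 ?(ltW p0) //.
  by rewrite mulVf // gt_eqF.
have e01 : 0 < eps <= 1 by rewrite eps0.
have [g [gd gu g01]] := zero_one_norming su u1 e01.
have gsum : (1 - eps) * fundamental M <= \sum_(i <- iota 0 M) nm (g i).
  move: gu; rewrite /u dotZ -rmorphV ?unitfE ?gt_eqF //
      nmM nm_emb ?invr_ge0 ?(ltW p0) //.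
  rewrite (mulrC (fundamental M)^-1) ler_pdivlMr // dot_block // => /le_trans;
    apply.
  exact: nm_sum.
pose p i := 1 - eps <= nm (g i).
pose A := [seq i <- iota 0 M | p i].
have [kA|Ak] := ltnP k (size A).
  have us : uniq (take k.+1 A) by rewrite take_uniq // filter_uniq // iota_uniq.
  have := dual_ball_sum gd us; rewrite size_takel // => h.
  have : k.+1%:R * (1 - eps) <= \sum_(i <- take k.+1 A) nm (g i).
    apply: (@le_trans _ _ (\sum_(i <- take k.+1 A) (1 - eps : R))).
      by rewrite big_const_seq count_predT iter_addr_0 size_takel // mulr_natl.
    rewrite big_seq [X in _ <= X]big_seq. apply: ler_sum => i /mem_take.
    by rewrite mem_filter => /andP[].
  by rewrite /a in epsa a0; lra.
have : \sum_(i <- iota 0 M) nm (g i) <= k%:R + M%:R * eps.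
  apply: (@le_trans _ _ (\sum_(i <- iota 0 M) ((p i)%:R + eps))).
    rewrite big_seq [X in _ <= X]big_seq; apply: ler_sum => i /sM /g01.
    have := dual_ball_le1 i gd.
    by case: (boolP (p i)) => [_|/negP np] g1 []//=; lra.
  rewrite big_split /= sum_indicator big_const_seq count_predT iter_addr_0.
  by rewrite size_iota mulr_natl lerD2r ler_nat -size_filter.
rewrite /b in epsb b0; nra.
Qed.

(** Suppose phi(k+1) < k+1, so that phi <= k.  By [block_coords] for two points, a
vector y_j of the unit ball with |y_j(j)| almost 1 has all its other coordinates
small, and a dual vector g takes on them a value of at most k times this small
bound.  Hence |g_j| is almost 1 for each of the k+1 first coordinates, which
gives phi(k+1) = k+1. *)
Lemma fundamental_full m : 2 <= fundamental 2 -> m%:R <= fundamental m.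
Proof.
move=> p2; case: m => [|k]; first exact: nm_ge0.
rewrite leNgt; apply/negP => pk.
have pb M := fundamental_bounded M pk.
pose a := k.+1%:R - fundamental k.+1; have a0 : 0 < a by rewrite subr_gt0.
pose d := a / (2 * k.+1%:R ^+ 2).
have k0 : 0 < k.+1%:R :> R by rewrite ltr0n.
have d0 : 0 < d by rewrite divr_gt0 ?mulr_gt0 ?exprn_gt0.
have dE : 2 * k.+1%:R ^+ 2 * d = a.
  by rewrite mulrC divfK // mulf_neq0 // ?expf_neq0 // gt_eqF.
have [N [ys [u [e1 [kN [[su u1 e10] [ysP gP]]]]]]] :=
  adp_list k.+1 k.+1 (fun j i => (i == j)%:R) (supported_unit (ltn0Sn k)) (nm_unit 0) d0.
have [g [gd /(_ N (leqnn N))]] := norming_supported su e10; rewrite u1 => gu.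
have [_ gys] := gP _ gd gu.
have gj j : (j < k.+1)%N -> 1 - k.+1%:R * d <= nm (g j).
  move=> jk; have [syj yj1 sharp] := ysP _ jk.
  have yjj : 1 - d <= nm (coord (ys j) j).
    by have := sharp (unit_vec j);
      rewrite !dot_delta // coord_unit eqxx nm1 nm_unit; apply.
  have gyj := gys _ jk.
  have small l : l != j -> nm (coord (ys j) l) <= d.
    move=> lj; have := @block_coords [:: l; j] (ys j).
    rewrite /= inE lj /= !big_cons big_nil addr0 => /(_ isT p2); lra.
  have jN : (j < N)%N := leq_trans jk kN.
  have : nm (dot N g (ys j)) <= nm (g j) + d * \sum_(i < N) nm (g i).
    apply: (le_trans (nm_sum _ _ _)); rewrite (bigD1 (Ordinal jN)) //=.
    apply: lerD.
      by rewrite nmM ler_piMr ?nm_ge0 // (le_trans (nm_coord _ _)).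
    rewrite mulr_sumr [X in _ <= X](bigD1 (Ordinal jN)) //=.
    apply: ler_wpDl; first by rewrite mulr_ge0 ?nm_ge0 ?(ltW d0).
    apply: ler_sum => i.
    by rewrite -val_eqE /= => ij; rewrite nmM mulrC ler_wpM2r ?nm_ge0 // small.
  have := le_trans (dual_ball_initial N gd) (pb N) => h1 h2.
  have : d * \sum_(i < N) nm (g i) <= d * k%:R by rewrite ler_wpM2l // ltW.
  by rewrite -natr1; lra.
have : \sum_(j < k.+1) (1 - k.+1%:R * d) <= fundamental k.+1.
  apply: le_trans (dual_ball_initial k.+1 gd); apply: ler_sum => j _; exact: gj.
rewrite sumr_const card_ord.
have -> : (1 - k.+1%:R * d) *+ k.+1 = k.+1%:R - a / 2.
  by rewrite -[LHS]mulr_natl -dE; field.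
by rewrite /a in a0 *; lra.
Qed.

Lemma nm_fin_vec_le N f : nm (fin_vec N f) <= \sum_(i < N) nm (f i).
Proof.
apply: (le_trans (nm_sum _ _ _)); apply: ler_sum => i _.
by rewrite nmZ nm_unit mulr1.
Qed.

(** By [block_coords] the coordinates of x are summable, and the norm of a tail is
at most its sum. *)
Lemma truncations_converge x eps : 2 <= fundamental 2 -> 0 < eps ->
  exists2 N, supported N (truncate N x) & nm (x - truncate N x) < eps.
Proof.
move=> p2 eps0.
have sx N : \sum_(i < N) nm (coord x i) <= nm x.
  rewrite -(big_mkord xpredT (fun i => nm (coord x i))) /index_iota subn0.
  by apply: block_coords; rewrite ?iota_uniq // size_iota fundamental_full.
pose P := [set \sum_(i < N) nm (coord x i) | N in [set: nat]]%classic.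
have hs : has_sup P.
  split; first by exists (\sum_(i < 0) nm (coord x i)); exists 0%N.
  by exists (nm x) => _ [N _ <-].
have e4 : 0 < eps / 4 by rewrite divr_gt0.
have [_ [N _ <-] ltN] := sup_adherent e4 hs.
exists N; first exact: supported_fin_vec.
have [N0 N0P] := fatou (x - truncate N x) e4.
have := N0P (maxn N0 N) (leq_maxl _ _).
have NM : (N <= maxn N0 N)%N := leq_maxr N0 N; set M := maxn N0 N in NM *.
have : nm (truncate M (x - truncate N x)) <= \sum_(N <= i < M) nm (coord x i).
  apply: (le_trans (nm_fin_vec_le _ _)).
  rewrite (sum_ord_cat (fun i => nm (coord (x - truncate N x) i)) NM).
  rewrite big1 ?add0r; last first.
    by move=> i _; rewrite coordB coord_fin_vec ltn_ord subrr nm0.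
  rewrite big_nat_cond [X in _ <= X]big_nat_cond; apply: ler_sum => i.
  move=> /andP[/andP[Ni _] _].
  by rewrite coordB coord_fin_vec ltnNge Ni /= subr0.
have sM : \sum_(i < M) nm (coord x i) <= sup P.
  by apply: sup_upper_bound => //; exists M.
rewrite (sum_ord_cat (fun i => nm (coord x i)) NM) in sM.
lra.
Qed.

(** * Separability and the bidual *)

(** The nets of the unit disc, dilated by integers, provide a countable dense
set of scalars to be used as coordinates. *)
Lemma separable_of_finite_approx :
  (forall x eps, 0 < eps -> exists N z, supported N z /\ nm (x - z) < eps) ->
  separable X.
Proof.
move=> approx; have [L LP] := choice (disc_net scalars).
pose q (t : nat * nat * nat) : K := t.1.1%:R * nth 0 (L t.1.2) t.2.
have q_dense a d : 0 < d -> exists t, nm (a - q t) < d.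
  move=> d0; pose b := (Num.bound (nm a)).+1.
  have b0 : 0 < b%:R :> R by rewrite ltr0n.
  have b0' : b%:R != 0 :> K by rewrite pnatr_eq0.
  have nb : nm (b%:R : K) = b%:R by rewrite -(rmorph_nat emb) nm_emb // ler0n.
  have ab : nm a <= b%:R.
    by rewrite (le_trans (ltW (archi_boundP (nm_ge0 a)))) // ler_nat.
  have ab1 : `|a / b%:R| <= 1.
    suff : nm (a / b%:R) <= 1 by rewrite nm_le_emb rmorph1.
    rewrite -(ler_pM2r b0) mul1r.
    by have := nmM (a / b%:R) b%:R; rewrite divfK // nb => <-.
  have [w wL wP] := LP (Num.bound (b%:R / d)) _ ab1.
  exists (b, Num.bound (b%:R / d), index w (L (Num.bound (b%:R / d)))).
  rewrite /q /= nth_index //.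
  have -> : a - b%:R * w = b%:R * (a / b%:R - w)
      by rewrite mulrBr mulrCA divff ?mulr1.
  rewrite nmM nb mulrC -ltr_pdivlMr //; apply: (lt_le_trans wP).
  rewrite -[X in _ <= X]invf_div lef_pV2 ?posrE ?divr_gt0 ?ltr0n //.
  have bd : 0 <= b%:R / d by rewrite divr_ge0 ?ltW.
  by rewrite (le_trans (ltW (archi_boundP bd))) // ler_nat.
pose S (s : seq (nat * nat * nat)) : X :=
    fin_vec (size s) (fun i => q (nth (0, 0, 0)%N s i)).
exists (range S); split.
  by apply: card_le_trans (card_image_le _ _) _; apply: countableP.
move=> O [x Ox] oO.
have /nbhs_ballP [r /= r0 rO] : nbhs x O by apply: open_nbhs_nbhs.
have e0 := rho_gt0 r0.
have e2 : 0 < rho r / 2 by rewrite divr_gt0.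
have [N [z [sz xz]]] := approx x _ e2.
have dN : 0 < rho r / 2 / N.+1%:R by rewrite divr_gt0 ?ltr0n.
have [t tP] := choice (fun i => q_dense (coord z i) _ dN).
exists (S (mkseq t N)); split; last by exists (mkseq t N).
apply: rO; rewrite -ball_normE /= -(emb_rho scalars (ltW r0)) -nm_lt_emb.
have -> : x - S (mkseq t N) = (x - z) + (z - S (mkseq t N)) by rewrite addrA subrK.
apply: (le_lt_trans (nmD _ _)).
suff : nm (z - S (mkseq t N)) <= rho r / 2 by lra.
have -> : z - S (mkseq t N) = fin_vec N (fun i => coord z i - q (t i)).
  apply: coord_inj => i; rewrite coordB /S !coord_fin_vec size_mkseq;
    case: ltnP => iN.
    by rewrite nth_mkseq.
  by rewrite sz // subr0.
apply: (le_trans (nm_fin_vec_le _ _)).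
apply: (@le_trans _ _ (\sum_(i < N) (rho r / 2 / N.+1%:R : R))).
  by apply: ler_sum => i _; apply: ltW.
rewrite sumr_const card_ord -[X in X <= _]mulr_natr mulrAC ler_pdivrMr ?ltr0n //.
by rewrite ler_pM2l // ler_nat.
Qed.

(** A summable sequence tends to 0, so it eventually avoids each of its finitely
many nonzero values. *)
Lemma simple_finite_support (f : K^nat) : simple_integrable f ->
  exists N, forall i, (N <= i)%N -> f i = 0.
Proof.
move=> [/finite_seqP [s fs] /cvg_series_cvg_0 /cvgrPdist_lt f0].
have [N _ NP] : (\forall n \near \oo, forall a, a \in s -> a != 0 ->
    f n != a)%classic.
  elim: {fs} s => [|a s IH]; first by exists 0%N.
  have [->|a0] := eqVneq a 0.
    apply: filterS IH => n H b; rewrite in_cons => /orP[/eqP ->|]; last exact: H.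
    by rewrite eqxx.
  have := f0 `|a|; rewrite normr_gt0 => /(_ a0) fa.
  apply: filterS2 IH fa => n H /= fa b; rewrite in_cons => /orP[/eqP -> _|];
    last exact: H.
  by apply/eqP => fna; move: fa; rewrite fna sub0r normrN normr_id ltxx.
exists N => i Ni; apply/eqP; apply: contraT => fi.
have fis : f i \in s by have : range f (f i) by [exists i]; rewrite fs.
by have := NP i Ni _ fis fi; rewrite eqxx.
Qed.

Lemma span_finite_support (f : K^nat) :
  linear_span [set f | bidual c f /\ simple_integrable f]%classic f ->
  exists N, forall i, (N <= i)%N -> f i = 0.
Proof.
move=> [n [a [s [sP ->]]]].
have /choice [M MP] : forall i : 'I_n, exists N, forall j, (N <= j)%N -> s i j = 0.
  by move=> i; have [_ /simple_finite_support] := sP i.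
exists (\max_(i < n) M i) => j Mj; rewrite big1 // => i _.
by rewrite MP ?mulr0 // (leq_trans _ Mj) // leq_bigmax.
Qed.

(** Because X' is norming, the norm of X'' used in the closed span is that of X;
the second alternative would make the finitely supported sequences dense. *)
Lemma range_bidual : ~ separable X -> range c = bidual c.
Proof.
move=> ns; case: (ri_bidual X_ri) => // rc; exfalso; apply: ns.
apply: separable_of_finite_approx => x eps eps0.
have [_ /(_ (emb eps))] : bidual_closed_span c
    [set f | bidual c f /\ simple_integrable f]%classic (c x).
  by rewrite -rc; exists x.
rewrite emb_gt0 => /(_ eps0) [s /span_finite_support [N sN] lt].
exists N, (fin_vec N s); split; first exact: supported_fin_vec.
rewrite nm_lt_emb (ri_norming X_ri) /=.
suff -> : c (x - fin_vec N s) = (fun k => c x k - s k) by [].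
apply/funext => k; rewrite -/(coord _ k) coordB coord_fin_vec;
  case: ltnP => // /sN ->.
by [].
Qed.

Theorem ri_adp_is_linfty : ~ separable X -> is_linfty c.
Proof.
move=> ns; have p2 : fundamental 2 < 2%:R.
  rewrite ltNge; apply/negP => p2; apply: ns.
  apply: separable_of_finite_approx => x eps eps0.
  by have [N sN lt] := truncations_converge x p2 eps0; exists N, (truncate N x).
have p1 M : fundamental M <= 1 := fundamental_bounded (k := 1) M p2.
split.
  apply/seteqP; split=> [f [x _ <-]|f /in_linftyP [B fB]].
    exact: (ri_linfty X_ri x).1.
  (* X' is contained in l1: test g on the indicators of the initial segments. *)
  rewrite (range_bidual ns) => g /kdual_bounded [C [C0 gC]].
  have B0 : 0 <= B := le_trans (nm_ge0 _) (fB 0%N).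
  apply: (@bound_in_l1 _ (B * C)) => N.
  apply: (@le_trans _ _ (\sum_(i < N) B * nm (g i))).
    by apply: ler_sum => i _; rewrite nmM ler_wpM2r ?nm_ge0.
  rewrite -mulr_sumr ler_wpM2l //.
  have gN := gC (block (iota 0 N)) N.
  apply: (@le_trans _ _ (C * fundamental N)); last by rewrite ler_piMr.
  apply: le_trans gN; apply: ler_sum => i _.
  by rewrite coord_block ?iota_uniq // mem_iota /= ltn_ord nm1 mulr1.
move=> x; have [bx lx] := ri_linfty X_ri x.
have [B xB] := (in_linftyP _).1 bx.
have [||s [es us _]] := @supremum_lub (range (fun n => `|c x n|)) B.
- by exists `|c x 0%N|; exists 0%N.
- by move=> a [k _ <-]; split=> //; rewrite -nm_le_emb; apply: xB.
apply/le_anti/andP; split; last exact: lx.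
rewrite /linfty_norm es -nm_le_emb; apply/ler_addgt0Pr => eps eps0.
have us' i : nm (coord x i) <= s by apply: us; exists i.
have s0 : 0 <= s := le_trans (nm_ge0 _) (us' 0%N).
have [g [gd [N gN]]] := norming x eps0.
have := gN N (leqnn N).
suff : nm (dot N g x) <= s by lra.
apply: (le_trans (nm_sum _ _ _)).
apply: (@le_trans _ _ (\sum_(i < N) nm (g i) * s)).
  by apply: ler_sum => i _; rewrite nmM ler_wpM2l ?nm_ge0.
rewrite -mulr_suml ler_piMl // (le_trans _ (p1 N)) //.
exact: dual_ball_initial.
Qed.

End Space.
End Scalars.

(** * The two scalar fields *)

Lemma real_scalars_real (R : realType) :
  @real_scalars R R (idfun : {rmorphism R -> R}) id.
Proof.
split=> //= [t v q|n].
  by rewrite !real_normK ?num_real //; ring.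
exists [seq k%:R / n.+2%:R - 1 | k <- iota 0 (2 * n.+2).+1] => z.
rewrite ler_norml => /andP[z1 z2].
have n0 : 0 < n.+2%:R :> R by rewrite ltr0n.
have y0 : 0 <= (z + 1) * n.+2%:R by rewrite mulr_ge0 // -lerBlDr sub0r.
pose k := Num.truncn ((z + 1) * n.+2%:R).
have /andP[k1 k2] := truncn_itv y0.
exists (k%:R / n.+2%:R - 1).
  apply/mapP; exists k => //; rewrite mem_iota add0n /= ltnS.
  rewrite -(ler_nat R) (le_trans k1) // natrM ler_wpM2r // -natr1; lra.
have -> : z - (k%:R / n.+2%:R - 1) = ((z + 1) * n.+2%:R - k%:R) / n.+2%:R.
  by field; rewrite gt_eqF.
rewrite ger0_norm ?divr_ge0 ?subr_ge0 // ltr_pdivrMr // .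
apply: (@lt_trans _ _ 1); first by rewrite ltrBlDl natr1.
by rewrite mulrC ltr_pdivlMr ?ltr0n // mul1r ltr_nat.
Qed.

Lemma sqr_Re_normc (R : realType) (z : R[i]) :
  complex.Re `|z| ^+ 2 = complex.Re z ^+ 2 + complex.Im z ^+ 2.
Proof. by rewrite normc_def /= sqr_sqrtr // addr_ge0 ?sqr_ge0. Qed.

Lemma real_scalars_complex (R : realType) :
  @real_scalars R R[i] (real_complex R) (@complex.Re R).
Proof.
split.
- by move=> x y; rewrite lecR.
- by move=> z z0; exact: (RRe_real (ger0_real z0)).
- move=> t [v1 v2] [q1 q2]; rewrite !sqr_Re_normc /=; ring.
move=> n; have [L LP] := disc_net (real_scalars_real R) (2 * n).+1.
exists [seq (Complex a b) | a <- L, b <- L] => -[a b] z1.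
have ab1 : a ^+ 2 + b ^+ 2 <= 1.
  move: z1; rewrite normc_def /= -(rmorph1 (real_complex R)) lecR => z1.
  rewrite -[X in X <= _]sqr_sqrtr ?addr_ge0 ?sqr_ge0 //.
  by rewrite expr_le1 ?sqrtr_ge0.
have [a' a'L aa'] : exists2 w, w \in L & `|a - w| < (2 * n).+2%:R^-1.
  apply: LP; rewrite -(@expr_le1 _ 2) // real_normK ?num_real //.
  by apply: le_trans ab1; rewrite ?lerDl ?lerDr sqr_ge0.
have [b' b'L bb'] : exists2 w, w \in L & `|b - w| < (2 * n).+2%:R^-1.
  apply: LP; rewrite -(@expr_le1 _ 2) // real_normK ?num_real //.
  by apply: le_trans ab1; rewrite ?lerDl ?lerDr sqr_ge0.
exists (Complex a' b'); first by apply/allpairsP; exists (a', b').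
have s0 : 0 <= complex.Re `|Complex a b - Complex a' b'|
    by rewrite normc_def /= sqrtr_ge0.
have sE : complex.Re `|Complex a b - Complex a' b'| ^+ 2 =
    `|a - a'| ^+ 2 + `|b - b'| ^+ 2.
  by rewrite sqr_Re_normc /= !real_normK ?num_real.
(* A point of the product net is within twice the mesh of the real net. *)
have n2 : n.+1%:R^-1 = (2 * n).+2%:R^-1 + (2 * n).+2%:R^-1 :> R.
  have -> : (2 * n).+2 = (2 * n.+1)%N by rewrite mulnS.
  by rewrite natrM; field; rewrite nat1r pnatr_eq0.
have a0 := normr_ge0 (a - a'); have b0 := normr_ge0 (b - b').
rewrite n2; apply: (@le_lt_trans _ _ (`|a - a'| + `|b - b'|)); last first.
  by rewrite ltrD.
rewrite -(@ler_sqr R) ?nnegrE ?addr_ge0 // sE.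
by have := mulr_ge0 a0 b0; lra.
Qed.

Unset Implicit Arguments.

Theorem theorem3p7 (R : realType) :
  (forall (X : completeNormedModType R) (c : {linear X -> (nat -> R^o)}),
     ri_space c -> ~ separable X -> alternative_Daugavet X ->
     is_linfty c) /\
  (forall (X : completeNormedModType R[i]) (c : {linear X -> (nat -> R[i]^o)}),
     ri_space c -> ~ separable X -> alternative_Daugavet X ->
     is_linfty c).
Proof.
split=> X c X_ri nsep adp.
  exact: (ri_adp_is_linfty (real_scalars_real R) X_ri adp nsep).
exact: (ri_adp_is_linfty (real_scalars_complex R) X_ri adp nsep).
Qed.
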